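(* Up to isomorphism and trivial equivalences, there are exactly two 3-cell templates $\mathcal{C}$ (alias Thom-Smale complexes of Sturm 3-ball global attractors) whose underlying cell complex is the solid tetrahedron. Both have pole distance $\delta=1$; one of them has smaller-hemisphere face count $\eta=1$, and the other one has $\eta=2$.
   Context: A finite regular CW-complex $\mathcal{C}=\bigcup_{v\in\mathcal{E}}c_v$ is a finite disjoint union of open cells $c_v$, labeled by barycenters $v\in\mathcal{E}$, whose characteristic maps $\overline{B}_v\to\overline{c}_v$ are homeomorphisms (including on the boundary) and such that each boundary $\partial c_v$ is a subcomplex of the skeleton of lower dimension. Cells of dimension 0, 1, 2 are called vertices, edges, faces. A bipolar orientation of the 1-skeleton is an orientation of all edges without directed cycles and with exactly one ''source'' vertex $\mathbf{N}$ (North pole) and exactly one ''sink'' vertex $\mathbf{S}$ (South pole). A finite regular cell complex $\mathcal{C}$ is called a 3-cell template if all of the following hold. (i) $\mathcal{C}=\mathrm{clos}\,c_{\mathcal{O}}=S^2\,\dot\cup\,c_{\mathcal{O}}$ is the closure of a single 3-cell $c_{\mathcal{O}}$. (ii) The 1-skeleton $\mathcal{C}^1$ carries a bipolar orientation from a pole vertex $\mathbf{N}$ to a pole vertex $\mathbf{S}$, with two directed meridian paths $\mathbf{WE}$ and $\mathbf{EW}$ from $\mathbf{N}$ to $\mathbf{S}$, disjoint except for the poles. The meridians decompose the boundary sphere $S^2=\partial c_{\mathcal{O}}$ into two remaining (open) hemisphere components $\mathbf{W}$ (West) and $\mathbf{E}$ (East). (iii) At end points on the meridians other than the poles $\mathbf{N},\mathbf{S}$,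 edges in $\mathbf{W}$ are directed towards the meridians and edges in $\mathbf{E}$ are directed away from the meridians. (iv) Let $\mathbf{NE}$ be the unique face in $\mathbf{W}$ containing the first edge of $\mathbf{WE}$ in its boundary, and $\mathbf{SW}$ the unique face in $\mathbf{E}$ containing the last edge of $\mathbf{WE}$ in its boundary. Then the boundaries of $\mathbf{NE}$ and $\mathbf{SW}$ share at least one edge of $\mathbf{WE}$. Similarly, let $\mathbf{NW}$ be the unique face in $\mathbf{W}$ adjacent to the first edge of $\mathbf{EW}$, and $\mathbf{SE}$ the unique face in $\mathbf{E}$ adjacent to the last edge of $\mathbf{EW}$. Then their boundaries share at least one edge of $\mathbf{EW}$. The data of a 3-cell template are the complex together with the bipolar orientation, the poles, the labeled meridians, and the labeled hemispheres; isomorphisms are cell-preserving homeomorphisms respecting all these data. Trivial equivalences: the Klein 4-group generated by two commuting involutions. $\kappa$ reverses all edge orientations and interchanges the labels $\mathbf{N}\leftrightarrow\mathbf{S}$, $\mathbf{WE}\leftrightarrow\mathbf{EW}$, $\mathbf{W}\leftrightarrow\mathbf{E}$. $\rho$ keeps all edge orientations, poles, and the labels of $\mathbf{W},\mathbf{E}$, and interchanges $\mathbf{WE}\leftrightarrow\mathbf{EW}$. The solid tetrahedron is the regular cell complex of a 3-cell whose boundary sphere complex is the boundary complex of the convex regular tetrahedron (4 vertices, 6 edges, 4 faces). The pole distance $\delta$ is the edge distance of $\mathbf{N}$ and $\mathbf{S}$ in the 1-skeleton $\mathcal{C}^1$. The number $\eta$ is the number of faces in the hemisphere ($\mathbf{W}$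 or $\mathbf{E}$) with fewer faces; by the trivial equivalence $\kappa$ this may be taken to be $\mathbf{W}$. Background: by earlier work of the same authors, 3-cell templates are exactly the Thom-Smale complexes (decompositions into unstable manifolds of equilibria, with signed hemisphere decomposition) of Sturm 3-ball global attractors of dissipative PDEs $u_t=u_{xx}+f(x,u,u_x)$ on $0<x<1$ with Neumann boundary conditions and hyperbolic equilibria, and the template determines the Sturm permutation uniquely. *)

(* Defs.v *)
From HB Require Import structures.
From mathcomp Require Import all_boot all_order all_algebra.
From mathcomp Require Import all_classical all_reals all_analysis.

Set Implicit Arguments.
Unset Strict Implicit.
Unset Printing Implicit Defensive.

Import Order.TTheory GRing.Theory Num.Theory.
Import numFieldNormedType.Exports.

Local Open Scope classical_set_scope.
Local Open Scope ring_scope.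

(* f restricts to a homeomorphism from A onto B, for the subspace topologies.
   The values of f outside A are irrelevant. *)
Definition homeo_on (T U : topologicalType) (A : set T) (B : set U)
    (f : T -> U) : Prop :=
  {within A, continuous f} /\
  exists g : U -> T,
    [/\ {within B, continuous g},
        forall x, A x -> B (f x),
        forall y, B y -> A (g y),
        forall x, A x -> g (f x) = x
      & forall y, B y -> f (g y) = y].

(* The norm of 'rV[R]_n in the library is the sup norm, hence the explicit
   Euclidean balls.  For n = 0 both are the one-point space. *)
Definition euclidean_open_ball (R : realType) (n : nat) : set 'rV[R]_n :=
  [set x : 'rV[R]_n | \sum_(i < n) x ord0 i ^+ 2 < 1].

Definition euclidean_closed_ball (R : realType) (n : nat) : set 'rV[R]_n :=
  [set x : 'rV[R]_n | \sum_(i < n) x ord0 i ^+ 2 <= 1].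

Definition cell_boundary (T : topologicalType) (c : set T) : set T :=
  closure c `\` c.

(* Finite regular CW-complexes.  The space is Hausdorff and is covered by
   finitely many compact closed cells, so its topology is the CW topology. *)
Record regular_complex (R : realType) := RegularComplex {
  cspace :> topologicalType;
  bary : finType;
  cell : bary -> set cspace;
  cdim : bary -> nat;
  cspace_hausdorff : hausdorff_space cspace;
  cells_cover : \bigcup_(v in [set: bary]) cell v = [set: cspace];
  cells_disjoint : forall v w : bary, v != w -> cell v `&` cell w = set0;
  characteristic_map : forall v : bary,
    exists chi : 'rV[R]_(cdim v) -> cspace,
      homeo_on (@euclidean_closed_ball R (cdim v)) (closure (cell v)) chi /\
      chi @` @euclidean_open_ball R (cdim v) = cell v;
  boundary_subcomplex : forall v : bary,
    exists D : {set bary},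
      [/\ cell_boundary (cell v) = \bigcup_(w in [set` D]) cell w,
          forall w, w \in D -> (cdim w < cdim v)%N
        & forall w, w \in D ->
            closure (cell w) `<=` \bigcup_(u in [set` D]) cell u]
}.

Arguments bary {R} r.
Arguments cell {R r} v.
Arguments cdim {R r} v.

(* The boundary complex of the convex regular tetrahedron, realized as the
   standard simplex of R^4 (all six edges have length sqrt 2): [open_face A]
   is the relative interior of the convex hull of the vertices in A. *)
Definition open_face (R : realType) (A : {set 'I_4}) : set 'rV[R]_4 :=
  [set x : 'rV[R]_4 | [/\ \sum_(i < 4) x ord0 i = 1,
               forall i, i \in A -> 0 < x ord0 i
             & forall i, i \notin A -> x ord0 i = 0]].

(* For A = set0 the open face is empty. *)
Definition tetrahedron_boundary (R : realType) : set 'rV[R]_4 :=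
  \bigcup_(A in [set A : {set 'I_4} | A != [set: 'I_4]%SET])
    @open_face R A.

(* The last clause says that [h] maps cells to cells, and is compatible with
   dimensions; since the cells partition both sides, [h] then induces a
   bijection between cells. *)
Definition solid_tetrahedron (R : realType) (C : regular_complex R) : Prop :=
  exists O : bary C,
    [/\ cdim O = 3%N, closure (cell O) = [set: C]
      & exists h : C -> 'rV[R]_4,
          homeo_on (cell_boundary (cell O)) (@tetrahedron_boundary R) h /\
          forall v : bary C, v != O ->
            exists A : {set 'I_4},
              #|A| = (cdim v).+1 /\ h @` cell v = @open_face R A].

(* The data carried by a 3-cell template.  An oriented edge e runs from
   [src e] to [tgt e]; the values of [src] and [tgt] on cells which are not
   edges are irrelevant.  Meridians are given by their sequences of edges,
   listed from N to S; hemispheres are sets of points. *)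
Record template_data (R : realType) := TemplateData {
  cplx :> regular_complex R;
  src : bary cplx -> bary cplx;
  tgt : bary cplx -> bary cplx;
  poleN : bary cplx;
  poleS : bary cplx;
  merWE : seq (bary cplx);
  merEW : seq (bary cplx);
  hemW : set cplx;
  hemE : set cplx
}.

Arguments src {R t} e : rename.
Arguments tgt {R t} e : rename.
Arguments poleN {R} t.
Arguments poleS {R} t.
Arguments merWE {R} t.
Arguments merEW {R} t.
Arguments hemW {R} t.
Arguments hemE {R} t.

Definition is_edge_orientation (R : realType) (T : template_data R) : Prop :=
  forall e : bary T, cdim e = 1%N ->
    [/\ cdim (src e) = 0%N, cdim (tgt e) = 0%N, src e != tgt e
      & cell_boundary (cell e) = cell (src e) `|` cell (tgt e)].

Fixpoint directed_path (R : realType) (T : template_data R)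
    (x : bary T) (p : seq (bary T)) (y : bary T) : Prop :=
  if p is e :: p' then
    [/\ cdim e = 1%N, src e = x & directed_path (tgt e) p' y]
  else x = y.

Definition bipolar (R : realType) (T : template_data R) : Prop :=
  [/\ is_edge_orientation T,
      forall (x : bary T) (p : seq (bary T)), directed_path x p x -> p = [::],
      forall v : bary T,
        (cdim v = 0%N /\ forall e : bary T, cdim e = 1%N -> tgt e <> v)
        <-> v = poleN T
    & forall v : bary T,
        (cdim v = 0%N /\ forall e : bary T, cdim e = 1%N -> src e <> v)
        <-> v = poleS T].

Definition path_support (R : realType) (C : regular_complex R)
    (p : seq (bary C)) : set C :=
  \bigcup_(e in [set` p]) closure (cell e).

Definition meridians (R : realType) (T : template_data R) : set T :=
  path_support (merWE T) `|` path_support (merEW T).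

Definition is_component (X : topologicalType) (M K : set X) : Prop :=
  exists2 x, M x & K = connected_component M x.

Definition face_at (R : realType) (C : regular_complex R) (H : set C)
    (e f : bary C) : Prop :=
  [/\ cdim f = 2%N, cell f `<=` H & cell e `<=` cell_boundary (cell f)].

(* f1 is the unique face in H1 at the edge e1, f2 is the unique face in H2 at
   the edge e2, and the boundaries of f1 and f2 share an edge of p. *)
Definition faces_overlap (R : realType) (C : regular_complex R)
    (p : seq (bary C)) (H1 : set C) (e1 : bary C) (H2 : set C) (e2 : bary C) :
    Prop :=
  exists f1 f2 : bary C,
    [/\ unique (face_at H1 e1) f1, unique (face_at H2 e2) f2
      & exists e, [/\ e \in p, cell e `<=` cell_boundary (cell f1)
                    & cell e `<=` cell_boundary (cell f2)]].

(* In the last two clauses [head] and [last] give the first and the last edge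
   of a meridian; their default value is not used, as meridians are nonempty
   by the other clauses. *)
Definition three_cell_template (R : realType) (T : template_data R) : Prop :=
  exists O : bary T,
    [/\ cdim O = 3%N /\ closure (cell O) = [set: T],
        bipolar T,
        [/\ directed_path (poleN T) (merWE T) (poleS T),
            directed_path (poleN T) (merEW T) (poleS T)
          & path_support (merWE T) `&` path_support (merEW T)
            = cell (poleN T) `|` cell (poleS T)],
        (let M := cell_boundary (cell O) `\` @meridians R T in
         [/\ is_component M (hemW T), is_component M (hemE T),
             hemW T <> hemE T & hemW T `|` hemE T = M])
      & [/\ forall v e : bary T,
              cdim v = 0%N -> cell v `<=` @meridians R T ->
              v <> poleN T -> v <> poleS T ->
              cdim e = 1%N -> src e = v \/ tgt e = v ->
              (cell e `<=` hemW T -> tgt e = v) /\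
              (cell e `<=` hemE T -> src e = v),
            faces_overlap (merWE T) (hemW T) (head O (merWE T))
                                    (hemE T) (last O (merWE T))
          & faces_overlap (merEW T) (hemW T) (head O (merEW T))
                                    (hemE T) (last O (merEW T))]].

Definition template_iso (R : realType) (T T' : template_data R) : Prop :=
  exists (f : T -> T') (phi : bary T -> bary T'),
    [/\ homeo_on [set: T] [set: T'] f,
        bijective phi,
        forall v, cdim (phi v) = cdim v /\ f @` cell v = cell (phi v),
        forall e, cdim e = 1%N ->
          src (phi e) = phi (src e) /\ tgt (phi e) = phi (tgt e)
      & [/\ phi (poleN T) = poleN T' /\ phi (poleS T) = poleS T',
            map phi (merWE T) = merWE T', map phi (merEW T) = merEW T',
            f @` hemW T = hemW T' & f @` hemE T = hemE T']].

(* Reversal of all edges turns a meridian from N to S into one from S to N,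
   so the sequences of edges are reversed when N and S are interchanged. *)
Definition kappa (R : realType) (T : template_data R) : template_data R :=
  @TemplateData R (cplx T) tgt src (poleS T) (poleN T)
    (rev (merEW T)) (rev (merWE T)) (hemE T) (hemW T).

Definition rho (R : realType) (T : template_data R) : template_data R :=
  @TemplateData R (cplx T) src tgt (poleN T) (poleS T)
    (merEW T) (merWE T) (hemW T) (hemE T).

Definition trivially_equivalent (R : realType) (T T' : template_data R) : Prop :=
  [\/ template_iso T T', template_iso T (kappa T'), template_iso T (rho T')
    | template_iso T (kappa (rho T'))].

Definition skeleton_adj (R : realType) (T : template_data R) : rel (bary T) :=
  fun x y => [exists e : bary T, (cdim e == 1)%N &&
    (((src e == x) && (tgt e == y)) || ((src e == y) && (tgt e == x)))].

Definition pole_distance (R : realType) (T : template_data R) (d : nat) : Prop :=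
  (exists p : seq (bary T),
     [/\ path (@skeleton_adj R T) (poleN T) p, last (poleN T) p = poleS T
       & size p = d]) /\
  (forall p : seq (bary T),
     path (@skeleton_adj R T) (poleN T) p -> last (poleN T) p = poleS T ->
     (d <= size p)%N).

Definition face_count (R : realType) (C : regular_complex R) (H : set C) : nat :=
  #|[set f : bary C | (cdim f == 2)%N && `[< cell f `<=` H >]]%SET|.

Definition smaller_face_count (R : realType) (T : template_data R) : nat :=
  minn (face_count (hemW T)) (face_count (hemE T)).

Definition tetrahedron_template (R : realType) (T : template_data R) : Prop :=
  three_cell_template T /\ solid_tetrahedron T.

(* Main.v *)
Require Import Defs.
From mathcomp Require Import all_boot all_order all_algebra all_fingroup.
From mathcomp Require Import all_classical all_reals all_analysis.
From mathcomp Require Import zify ring.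

(* Coning off (the Alexander trick) extends any label-preserving homeomorphism
   between the boundary spheres of two solid tetrahedra over their 3-cells, so a
   template is determined up to isomorphism by combinatorial data on the face
   lattice of the tetrahedron.  An acyclic orientation of the complete graph on
   four vertices is a linear order 0 < 1 < 2 < 3, with N = 0 and S = 3, and the
   meridians are increasing paths from 0 to 3.  Four unordered pairs of such
   paths are disjoint off the poles; each of them cuts the boundary into two
   components, each being the open star of a simplex.  Clause (iii) decides
   which one is W, and excludes the pair {013, 023}.  The pairs {03, 013} and
   {03, 023} are exchanged by kappa and give eta = 1; {03, 0123} gives
   eta = 2. *)

Set Implicit Arguments.
Unset Strict Implicit.
Unset Printing Implicit Defensive.
Import Order.TTheory GRing.Theory Num.Theory.
Import numFieldNormedType.Exports.
Local Open Scope classical_set_scope.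
Local Open Scope ring_scope.

(** * Homeomorphisms of subspaces and cones *)

(** The 3-cell is known only through its characteristic map from the round ball, and the labels only
    on its boundary. So the homeomorphism between boundary spheres is transported to the unit
    sphere, coned there and transported back. Conversely, existence requires an actual regular
    complex: the standard simplex of R^4 with its open faces, whose characteristic maps are
    homeomorphisms from round balls to simplices. Both tasks use one cone construction, stated for
    gauges rather than norms because a simplex is not symmetric about its barycenter. The components
    are found from the face relation alone. Every cell of an open star has the central cell in its
    closure, so the star is connected; two stars are separated when no cell of one is a face of a
    cell of the other. What remains is a finite statement about subsets of {0, 1, 2, 3}, settled by
    evaluating Boolean functions on lists. *)

Lemma within_continuous_compose (T U V : topologicalType) (A : set T)
    (B : set U) (f : T -> U) (g : U -> V) :
  {within A, continuous f} -> (forall x, A x -> B (f x)) ->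
  {within B, continuous g} -> {within A, continuous (g \o f)}.
Proof.
move=> /subspace_continuousP cf fAB /subspace_continuousP cg.
apply/subspace_continuousP => x Ax; apply: cvg_comp (cg _ (fAB _ Ax)).
move=> W nW; have := cf _ Ax _ nW; apply: filterS2 (withinT _ _) => z Az.
by apply; exact: fAB.
Qed.

Section HomeoOn.
Context {T U V : topologicalType}.

Lemma homeo_on_comp (A : set T) (B : set U) (C : set V) (f : T -> U)
    (g : U -> V) : homeo_on A B f -> homeo_on B C g -> homeo_on A C (g \o f).
Proof.
move=> [cf [f' [cf' fAB f'BA fK f'K]]] [cg [g' [cg' gBC g'CB gK g'K]]].
split; first exact: within_continuous_compose cf fAB cg.
exists (f' \o g'); split => [|x Ax|x Cx|x Ax|x Cx] /=.
- exact: within_continuous_compose cg' g'CB cf'.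
- exact/gBC/fAB.
- exact/f'BA/g'CB.
- by rewrite gK ?fK //; exact: fAB.
- by rewrite f'K ?g'K //; exact: g'CB.
Qed.

Lemma homeo_on_inverse (A : set T) (B : set U) (f : T -> U) :
  homeo_on A B f -> exists g : U -> T,
    [/\ homeo_on B A g, forall x, A x -> g (f x) = x
      & forall y, B y -> f (g y) = y].
Proof.
move=> [cf [g [cg fAB gBA fK gK]]]; exists g; split => //; split => //.
by exists f.
Qed.

Lemma homeo_on_subset (A A' : set T) (B B' : set U) (f : T -> U) :
  A' `<=` A -> B' `<=` B -> (forall x, A x -> A' x <-> B' (f x)) ->
  homeo_on A B f -> homeo_on A' B' f.
Proof.
move=> sA sB AB [cf [g [cg fAB gBA fK gK]]]; split.
  exact: continuous_subspaceW cf.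
exists g; split => [|x A'x|y B'y|x A'x|y B'y].
- exact: continuous_subspaceW cg.
- exact/AB/A'x/sA.
- by apply/AB; [exact/gBA/sB|rewrite gK //; exact: sB].
- exact/fK/sA.
- exact/gK/sB.
Qed.

Lemma homeo_on_image (A : set T) (B : set U) (f : T -> U) :
  homeo_on A B f -> f @` A = B.
Proof.
move=> [cf [g [cg fAB gBA fK gK]]]; apply/seteqP; split => [_ [x Ax <-]|y By].
  exact: fAB.
by exists (g y); [exact: gBA|exact: gK].
Qed.

Lemma homeo_on_inj (A : set T) (B : set U) (f : T -> U) x y :
  homeo_on A B f -> A x -> A y -> f x = f y -> x = y.
Proof.
by move=> [cf [g [cg fAB gBA fK gK]]] Ax Ay exy; rewrite -(fK _ Ax) exy fK.
Qed.

Lemma within_continuous_closure (A : set T) (C : set T) (f : T -> U) x :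
  {within A, continuous f} -> C `<=` A -> A x -> closure C x ->
  closure (f @` C) (f x).
Proof.
move=> /subspace_continuousP cf CA Ax clx W /(cf _ Ax) nW.
have [z [Cz /(_ (CA _ Cz)) Wz]] := clx _ nW.
by exists (f z); split => //; exists z.
Qed.

End HomeoOn.

(** Closures are taken in the ambient spaces. As [x] lies in [A], continuity of the map within [A]
    gives one direction and continuity of its inverse within [B] the other. *)
Lemma homeo_on_closure (T U : topologicalType) (A C : set T) (B : set U)
    (f : T -> U) x :
  homeo_on A B f -> C `<=` A -> A x ->
  closure C x <-> closure (f @` C) (f x).
Proof.
move=> hf CA Ax; split; first exact: within_continuous_closure hf.1 CA Ax.
have [g [hg fK gK]] := homeo_on_inverse hf.
have fA z : A z -> B (f z) by move=> Az; rewrite -(homeo_on_image hf); exists z.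
move=> clfx; have := within_continuous_closure hg.1 _ (fA _ Ax) clfx.
rewrite fK // image_comp => H.
suff -> : C = [set (g \o f) z | z in C].
  by apply: H => _ [z Cz <-]; exact/fA/CA.
apply/seteqP; split => [z Cz|_ [z Cz <-]] /=; last by rewrite fK //; exact: CA.
by exists z => //=; rewrite fK //; exact: CA.
Qed.

Section Cones.
Context {R : realType}.

(** A possibly asymmetric substitute for a norm, keeping only the radial structure. The bound on the
    unit sphere yields continuity of cones at the origin. *)
Definition gauge (V : normedModType R) (g : V -> R) : Prop :=
  [/\ continuous g, forall t y, 0 <= t -> g (t *: y) = t * g y,
      forall y, y != 0 -> 0 < g y
    & exists C, forall y, g y = 1 -> `|y| <= C].

Lemma gauge0 (V : normedModType R) (g : V -> R) : gauge g -> g 0 = 0.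
Proof. by move=> [_ gZ _ _]; rewrite -(scale0r 0) gZ ?mul0r. Qed.

Lemma gauge_normalized (V : normedModType R) (g : V -> R) y : gauge g ->
  y != 0 -> g ((g y)^-1 *: y) = 1.
Proof.
move=> [_ gZ g_gt0 _] /g_gt0 y0.
by rewrite gZ ?invr_ge0 ?ltW // mulVf // gt_eqF.
Qed.

Lemma gauge_eq1 (V : normedModType R) (g : V -> R) y : gauge g ->
  g y = 1 -> y != 0.
Proof.
move=> gg; apply: contra_eqN => /eqP ->.
by rewrite (gauge0 gg) eq_sym oner_neq0.
Qed.

(** The positively homogeneous extension of [phi] from the unit sphere. At the origin the factor
    [g y] vanishes, so the value of [phi] used there does not matter. *)
Definition cone (V W : normedModType R) (g : V -> R) (phi : V -> W) (y : V) :
    W := g y *: phi ((g y)^-1 *: y).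

Lemma cone0 (V W : normedModType R) (g : V -> R) (phi : V -> W) :
  gauge g -> cone g phi 0 = 0.
Proof. by move=> hg; rewrite /cone gauge0 // scale0r. Qed.

Section ConeContinuous.
Variables (V W : normedModType R) (gV : V -> R) (gW : W -> R) (phi : V -> W).
Hypotheses (gaugeV : gauge gV) (gaugeW : gauge gW).
Hypothesis phi_sphere : forall y, gV y = 1 -> gW (phi y) = 1.

Lemma gauge_cone y : gW (cone gV phi y) = gV y.
Proof.
have [->|y0] := eqVneq y 0.
  by rewrite cone0 // !gauge0.
have [_ _ gV_gt0 _] := gaugeV; have [_ gWZ _ _] := gaugeW.
rewrite /cone gWZ; last exact/ltW/gV_gt0.
by rewrite phi_sphere ?mulr1 //; exact: gauge_normalized.
Qed.

Lemma cone_sphere y : gV y = 1 -> cone gV phi y = phi y.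
Proof. by rewrite /cone => ->; rewrite invr1 !scale1r. Qed.

(** Off the origin, normalization lands on the sphere, so continuity of [phi] within the sphere
    suffices. At the origin the bounded unit sphere of [gW] bounds the cone by a multiple of
    [gV]. *)
Lemma continuous_cone : {within [set y | gV y = 1], continuous phi} ->
  continuous (cone gV phi).
Proof.
move=> /subspace_continuousP cphi y.
have [cg gZ g_gt0 _] := gaugeV.
have [->|y0] := eqVneq y 0.
  have [_ _ _ [C hC]] := gaugeW.
  rewrite /continuous_at cone0 //; apply/cvgrPdist_le => e e0.
  (* [C] may be nonpositive, for instance when the unit sphere is empty; this replaces it by a
     positive bound. *)
  have C1 : 0 < `|C| + 1 by rewrite ltr_wpDl.
  have : \forall z \near (0 : V), gV z < e / (`|C| + 1).
    have := cg 0; rewrite /continuous_at (gauge0 gaugeV) => /cvgrPdist_lt.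
    move=> /(_ _ (divr_gt0 e0 C1)); apply: filterS => z.
    by rewrite sub0r normrN; apply: le_lt_trans; exact: ler_norm.
  apply: filterS => z; rewrite ltr_pdivlMr // => hz.
  rewrite sub0r normrN; have [->|z0] := eqVneq z 0.
    by rewrite cone0 // normr0 ltW.
  apply: le_trans (ltW hz); rewrite /cone normrZ (gtr0_norm (g_gt0 _ z0)).
  rewrite ler_wpM2l ?(ltW (g_gt0 _ z0)) //.
  apply: le_trans (hC _ _) _; first exact/phi_sphere/gauge_normalized.
  by rewrite (le_trans (ler_norm C)) // lerDl.
have gy0 : gV y != 0 by rewrite gt_eqF ?g_gt0.
have cn : (fun z => (gV z)^-1 *: z) @ y --> (gV y)^-1 *: y.
  by apply: cvgZ; [apply: cvgV => //; exact: cg|exact: cvg_id].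
apply: cvgZ; first exact: cg.
apply: (@cvg_comp _ _ _ (fun z => (gV z)^-1 *: z) phi _
  (within [set y | gV y = 1] (nbhs ((gV y)^-1 *: y)))); last first.
  exact/cphi/gauge_normalized.
move=> A nA; have := cn _ nA.
have : \forall z \near y, z != 0.
  apply: open_nbhs_nbhs; split => //.
  rewrite (_ : (fun _ => _) = ~` [set 0]); last first.
    by apply/seteqP; split => z /=; [move/eqP|move/eqP].
  exact/closed_openC/accessible_closed_set1/hausdorff_accessible/norm_hausdorff.
by apply: filterS2 => z z0; apply; exact: gauge_normalized.
Qed.

End ConeContinuous.

Lemma coneK (V W : normedModType R) (gV : V -> R) (gW : W -> R)
    (phi : V -> W) (psi : W -> V) : gauge gV -> gauge gW ->
  (forall y, gV y = 1 -> gW (phi y) = 1) ->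
  (forall y, gV y = 1 -> psi (phi y) = y) ->
  cancel (cone gV phi) (cone gW psi).
Proof.
move=> hV hW hphi phiK y; rewrite [LHS]/cone gauge_cone //.
have [->|y0] := eqVneq y 0; first by rewrite (gauge0 hV) scale0r.
have gy0 : gV y != 0 by case: hV => _ _ h _; rewrite gt_eqF ?h.
rewrite /cone scalerA mulVf // scale1r phiK ?scalerA ?mulfV ?scale1r //.
exact: gauge_normalized.
Qed.

Lemma homeo_on_cone (V W : normedModType R) (gV : V -> R) (gW : W -> R)
    (phi : V -> W) : gauge gV -> gauge gW ->
  homeo_on [set y | gV y = 1] [set z | gW z = 1] phi ->
  homeo_on [set y | gV y <= 1] [set z | gW z <= 1] (cone gV phi) /\
  (forall y, gW (cone gV phi y) = gV y).
Proof.
move=> hV hW [cphi [psi [cpsi hphi hpsi phiK psiK]]].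
split; last by move=> y; exact: gauge_cone.
split; first by apply: continuous_subspaceT; exact: continuous_cone hV hW _ _.
exists (cone gW psi); split => [|y|y|y _|y _] /=.
- by apply: continuous_subspaceT; exact: continuous_cone hW hV _ _.
- by rewrite gauge_cone.
- by rewrite gauge_cone.
- exact: coneK.
- exact: coneK.
Qed.

Lemma homeo_on_radial (V : normedModType R) (g g' : V -> R) :
  gauge g -> gauge g' ->
  homeo_on [set y | g y = 1] [set y | g' y = 1] (fun y => (g' y)^-1 *: y).
Proof.
have cont (k k' : V -> R) : gauge k -> gauge k' ->
    {within [set y | k y = 1], continuous (fun y => (k' y)^-1 *: y)}.
  move=> hk [ck' _ k'_gt0 _]; apply: continuous_in_subspaceT => y.
  rewrite inE /= => ky; apply: cvgZ; last exact: cvg_id.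
  by apply: cvgV; [rewrite gt_eqF ?k'_gt0 ?(gauge_eq1 hk)|exact: ck'].
have inv (k k' : V -> R) : gauge k -> gauge k' ->
    forall y, k y = 1 -> (k ((k' y)^-1 *: y))^-1 *: ((k' y)^-1 *: y) = y.
  move=> hk hk' y ky; have [_ kZ _ _] := hk; have [_ _ k'_gt0 _] := hk'.
  have k'y := k'_gt0 _ (gauge_eq1 hk ky).
  by rewrite kZ ?invr_ge0 ?ltW // ky mulr1 invrK scalerA mulfV ?scale1r ?gt_eqF.
move=> hg hg'; split; first exact: cont.
exists (fun y => (g y)^-1 *: y); split => [|y /= gy|y /= gy|y /= gy|y /= gy].
- exact: cont.
- by apply: gauge_normalized => //; exact: gauge_eq1 gy.
- by apply: gauge_normalized => //; exact: gauge_eq1 gy.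
- exact: inv.
- exact: inv.
Qed.

Lemma homeo_on_gauge_ball (V : normedModType R) (g g' : V -> R) :
  gauge g -> gauge g' ->
  exists phi : V -> V,
    homeo_on [set y | g y <= 1] [set y | g' y <= 1] phi /\
    (forall y, g' (phi y) = g y).
Proof.
by move=> hg hg'; eexists; exact: homeo_on_cone (homeo_on_radial hg hg').
Qed.

Definition enorm (n : nat) (y : 'rV[R]_n) : R :=
  Num.sqrt (\sum_(i < n) y ord0 i ^+ 2).

Lemma sumsq_ge0 (n : nat) (y : 'rV[R]_n) : 0 <= \sum_(i < n) y ord0 i ^+ 2.
Proof. by apply: sumr_ge0 => i _; exact: sqr_ge0. Qed.

Lemma continuous_sum (T : topologicalType) (I : Type) (r : seq I) (P : pred I)
    (f : I -> T -> R) :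
  (forall i, P i -> continuous (f i)) ->
  continuous (fun y => \sum_(i <- r | P i) f i y).
Proof. by apply: continuous_big; exact: add_continuous. Qed.

Lemma continuous_bigmax (T : topologicalType) (I : Type) (x0 : R) (r : seq I)
    (P : pred I) (f : I -> T -> R) :
  (forall i, P i -> continuous (f i)) ->
  continuous (fun y => \big[Num.max/x0]_(i <- r | P i) f i y).
Proof.
apply: continuous_big => -[x y].
apply: (@continuous_max R (R * R)%type fst snd); first exact: cvg_fst.
exact: cvg_snd.
Qed.

Lemma gauge_enorm (n : nat) : gauge (@enorm n).
Proof.
split.
- move=> y; apply: continuous_comp; last exact: sqrt_continuous.
  apply: continuous_sum => i _ z.
  have c := @coord_continuous R 1 n ord0 i z; exact: (cvgM c c).
- move=> t y t0; rewrite /enorm; under eq_bigr do rewrite mxE exprMn.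
  by rewrite -mulr_sumr sqrtrM ?sqr_ge0 // sqrtr_sqr ger0_norm.
- move=> y; apply: contraNT; rewrite sqrtr_gt0 -leNgt => s0.
  apply/eqP/rowP => i; rewrite mxE; apply/eqP; rewrite -sqrf_eq0.
  have /psumr_eq0P/(_ i isT)/eqP -> // : \sum_(i < n) y ord0 i ^+ 2 = 0.
    by apply/eqP; rewrite eq_le s0 sumsq_ge0.
  by move=> j _; exact: sqr_ge0.
- exists 1 => y e1.
  have s1 : \sum_(i < n) y ord0 i ^+ 2 = 1.
    by rewrite -(sqr_sqrtr (sumsq_ge0 y)) -/(enorm y) e1 expr1n.
  rewrite [leLHS]mx_normrE; apply/bigmax_leP; split => // -[i j] _ /=.
  rewrite ord1 -(@expr_le1 _ 2) // real_normK ?num_real //.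
  by rewrite -s1 (bigD1 j) //= lerDl sumr_ge0 // => k _; exact: sqr_ge0.
Qed.

Lemma enorm_le1 (n : nat) (y : 'rV[R]_n) :
  (enorm y <= 1) = (\sum_(i < n) y ord0 i ^+ 2 <= 1).
Proof. by rewrite /enorm -{1}(sqrtr1 R) ler_sqrt. Qed.

Lemma enorm_lt1 (n : nat) (y : 'rV[R]_n) :
  (enorm y < 1) = (\sum_(i < n) y ord0 i ^+ 2 < 1).
Proof. by rewrite /enorm -{1}(sqrtr1 R) ltr_sqrt. Qed.

Lemma euclidean_closed_ballE (n : nat) :
  @euclidean_closed_ball R n = [set y | enorm y <= 1].
Proof. by apply/seteqP; split => y /=; rewrite enorm_le1. Qed.

Lemma euclidean_open_ballE (n : nat) :
  @euclidean_open_ball R n = [set y | enorm y < 1].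
Proof. by apply/seteqP; split => y /=; rewrite enorm_lt1. Qed.

End Cones.

(** * Closed faces of the simplex as balls *)

Lemma continuous_row (R : numFieldType) (T : topologicalType) (n : nat)
    (f : T -> 'rV[R]_n) (g : 'I_n -> T -> R) :
  (forall y i, f y ord0 i = g i y) -> (forall i, continuous (g i)) ->
  continuous f.
Proof.
move=> fg cg x B [P nP PB].
have : \forall z \near x, forall ij : 'I_1 * 'I_n,
    P ij.1 ij.2 (f z ij.1 ij.2).
  apply: filter_forall => -[i j] /=.
  have := nP i j; rewrite !ord1 fg => nPj.
  by near do rewrite fg; exact: (cg j x _ nPj).
by apply: filterS => z hz; apply: PB => i j; exact: (hz (i, j)).
Unshelve. all: by end_near. Qed.

Section SimplexChart.
Context {R : realType}.

Lemma invSn_mulrS (n : nat) : n.+1%:R^-1 *+ n.+1 = 1 :> R.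
Proof. by rewrite -(mulr_natr n.+1%:R^-1) mulVf. Qed.

Definition closed_face (A : {set 'I_4}) : set 'rV[R]_4 :=
  [set x : 'rV[R]_4 | [/\ \sum_(i < 4) x ord0 i = 1, forall i, 0 <= x ord0 i
               & forall i, i \notin A -> x ord0 i = 0]].

Lemma sub_open_closed_face (A : {set 'I_4}) : @open_face R A `<=` closed_face A.
Proof.
move=> x [s1 x_gt0 x0]; split => // i.
by case: (boolP (i \in A)) => [/x_gt0/ltW //|/x0 ->].
Qed.

(* Coordinates on the hyperplane of vectors of R^(n+1) with zero sum. *)
Definition ext (n : nat) (y : 'rV[R]_n) (k : 'I_n.+1) : R :=
  oapp (fun j => y ord0 j) (- \sum_(j < n) y ord0 j) (unlift ord0 k).

Lemma ext_lift (n : nat) (y : 'rV[R]_n) j : ext y (lift ord0 j) = y ord0 j.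
Proof. by rewrite /ext liftK. Qed.

Lemma ext0 (n : nat) (y : 'rV[R]_n) : ext y ord0 = - \sum_(j < n) y ord0 j.
Proof. by rewrite /ext unlift_none. Qed.

Lemma sum_ext (n : nat) (y : 'rV[R]_n) : \sum_(k < n.+1) ext y k = 0.
Proof.
rewrite big_ord_recl ext0.
by under [X in _ + X]eq_bigr do rewrite ext_lift; rewrite addNr.
Qed.

Lemma extZ (n : nat) t (y : 'rV[R]_n) k : ext (t *: y) k = t * ext y k.
Proof.
rewrite /ext; case: unliftP => [j|] _ /=; first by rewrite mxE.
by under eq_bigr do rewrite mxE; rewrite -mulr_sumr mulrN.
Qed.

Lemma continuous_ext (n : nat) (k : 'I_n.+1) : continuous (fun y => ext y k).
Proof.
rewrite /ext; case: unliftP => [j|] _ /=; first exact: coord_continuous.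
have c := @continuous_sum R 'rV[R]_n _ (index_enum _) xpredT
  (fun j y => y ord0 j) (fun j _ => @coord_continuous R 1 n ord0 j).
by move=> y; exact: (cvgN (c y)).
Qed.

(** The Minkowski functional of the standard simplex translated so that its barycenter is the
    origin; the barycentric coordinates are [n.+1%:R^-1 + ext y k]. Since the [ext y k] sum to 0,
    one of them is nonpositive, so the initial value 0 does not alter the maximum. *)
Definition simplex_gauge (n : nat) (y : 'rV[R]_n) : R :=
  \big[Num.max/0]_(k < n.+1) (n.+1%:R * - ext y k).

Lemma simplex_gauge_le1 (n : nat) (y : 'rV[R]_n) :
  simplex_gauge y <= 1 <-> forall k, 0 <= n.+1%:R^-1 + ext y k.
Proof.
have E k : (n.+1%:R * - ext y k <= 1) = (0 <= n.+1%:R^-1 + ext y k).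
  by rewrite mulrC -ler_pdivlMr ?ltr0Sn // div1r lerNl -subr_ge0 opprK addrC.
split => [/bigmax_leP[_ h] k|h]; first by rewrite -E h.
by apply/bigmax_leP; split => // k _; rewrite E.
Qed.

Lemma simplex_gauge_lt1 (n : nat) (y : 'rV[R]_n) :
  simplex_gauge y < 1 <-> forall k, 0 < n.+1%:R^-1 + ext y k.
Proof.
have E k : (n.+1%:R * - ext y k < 1) = (0 < n.+1%:R^-1 + ext y k).
  by rewrite mulrC -ltr_pdivlMr ?ltr0Sn // div1r ltrNl -subr_gt0 opprK addrC.
split => [/bigmax_ltP[_ h] k|h]; first by rewrite -E h.
by apply/bigmax_ltP; split => // k _; rewrite E.
Qed.

Lemma gauge_simplex (n : nat) : gauge (@simplex_gauge n).
Proof.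
split.
- apply: continuous_bigmax => k _ y.
  have c := @continuous_ext n k y.
  by apply: (cvgM _ (cvgN c)); exact: cvg_cst.
- move=> t y t0; rewrite /simplex_gauge.
  elim/big_ind2 : _ => [|a b c d -> ->|k _]; first by rewrite mulr0.
    by rewrite maxr_pMr.
  by rewrite extZ -mulrN mulrCA.
(* A nonpositive gauge makes all [ext y k] nonnegative; their sum is 0, so they vanish. *)
- move=> y; apply: contraNT; rewrite -leNgt => /bigmax_leP[_ h].
  have ext_ge0 k : 0 <= ext y k.
    by have := h k isT; rewrite pmulr_rle0 ?ltr0Sn // oppr_le0.
  apply/eqP/rowP => j; rewrite mxE -ext_lift.
  by have /psumr_eq0P/(_ (lift ord0 j) isT) -> := sum_ext y.
- exists 1 => y g1.
  have /simplex_gauge_le1 h : simplex_gauge y <= 1 by rewrite g1.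
  rewrite [leLHS]mx_normrE; apply/bigmax_leP; split => // -[i j] _ /=.
  rewrite ord1 -ext_lift; set k0 := lift ord0 j; rewrite ler_norml.
  have c1 : n.+1%:R^-1 <= 1 :> R by rewrite invf_le1 ?ltr0Sn // ler1n.
  apply/andP; split.
    by have := h k0; rewrite -lerBlDl sub0r; apply: le_trans; rewrite lerN2.
  have : \sum_(k < n.+1) (n.+1%:R^-1 + ext y k) = 1.
    by rewrite big_split /= sum_ext addr0 sumr_const card_ord invSn_mulrS.
  rewrite (bigD1 k0) //= => e; rewrite -e -addrA addrCA lerDl.
  by rewrite addr_ge0 ?invr_ge0 ?ler0n // sumr_ge0.
Qed.

Section Embedding.
Variables (A : {set 'I_4}) (n : nat).
Hypothesis cardA : #|A| = n.+1.

Let rk (i : 'I_4) : 'I_n.+1 := inord (index i (enum A)).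
Let pt (k : 'I_n.+1) : 'I_4 := nth ord0 (enum A) k.

Let pt_in k : pt k \in A.
Proof. by rewrite -mem_enum mem_nth // -cardE cardA. Qed.

Let ptK k : rk (pt k) = k.
Proof.
apply/val_inj; rewrite /rk /pt index_uniq ?enum_uniq //.
  by rewrite /= inordK.
by rewrite -cardE cardA.
Qed.

Let rkK i : i \in A -> pt (rk i) = i.
Proof.
move=> iA; rewrite /pt inordK ?nth_index ?mem_enum //.
by rewrite -cardA cardE index_mem mem_enum.
Qed.

Let emb (y : 'rV[R]_n) : 'rV[R]_4 :=
  \row_i (if i \in A then n.+1%:R^-1 + ext y (rk i) else 0).

Let embV (x : 'rV[R]_4) : 'rV[R]_n :=
  \row_j (x ord0 (pt (lift ord0 j)) - n.+1%:R^-1).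

Let sum_pt (F : 'I_4 -> R) : \sum_(i in A) F i = \sum_(k < n.+1) F (pt k).
Proof.
rewrite (reindex_onto pt rk) => [|i]; last exact: rkK.
by apply: eq_bigl => k; rewrite pt_in ptK eqxx.
Qed.

Let sum_emb y : \sum_(i < 4) emb y ord0 i = 1.
Proof.
rewrite (bigID (mem A)) /= [X in _ + X]big1 ?addr0; last first.
  by move=> i /negPf iA; rewrite mxE iA.
rewrite sum_pt (eq_bigr (fun k => n.+1%:R^-1 + ext y k)) => [|k _]; last first.
  by rewrite mxE pt_in ptK.
by rewrite big_split /= sum_ext addr0 sumr_const card_ord invSn_mulrS.
Qed.

Let embK : cancel emb embV.
Proof.
by move=> y; apply/rowP => j; rewrite !mxE pt_in ptK ext_lift addrC addKr.
Qed.

Let embVK x : closed_face A x -> emb (embV x) = x.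
Proof.
move=> [s1 _ x0]; apply/rowP => i; rewrite mxE; case: ifPn => [iA|/x0 //].
suff E k : n.+1%:R^-1 + ext (embV x) k = x ord0 (pt k) by rewrite E rkK.
case: (unliftP ord0 k) => [j ->|->]; first by rewrite ext_lift mxE addrC subrK.
rewrite ext0.
have : \sum_(i in A) x ord0 i = 1.
  by rewrite -s1 [RHS](bigID (mem A)) /= [X in _ = _ + X]big1 ?addr0.
rewrite sum_pt big_ord_recl; under [in X in _ -> X]eq_bigr do rewrite mxE.
rewrite big_split /= sumrN sumr_const card_ord.
move=> /(canRL (addrK _)) ->; set S := \sum_(i < n) _.
have := invSn_mulrS n; rewrite mulrS; set u := _ *+ n => /(canRL (addrK _)) ->.
by ring.
Qed.

Let emb_range y : simplex_gauge y <= 1 <-> closed_face A (emb y).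
Proof.
rewrite simplex_gauge_le1; split => [h|[_ h _] k].
  split => // i; rewrite mxE; first by case: ifP.
  by move/negPf ->.
by have := h (pt k); rewrite mxE pt_in ptK.
Qed.

Let emb_interior y : simplex_gauge y < 1 <-> @open_face R A (emb y).
Proof.
rewrite simplex_gauge_lt1; split => [h|[_ h _] k].
  by split => // i; rewrite mxE; [move=> ->|move/negPf ->].
by have := h _ (pt_in k); rewrite mxE pt_in ptK.
Qed.

Let continuous_emb : continuous emb.
Proof.
apply: (@continuous_row R _ _ _
  (fun i y => if i \in A then n.+1%:R^-1 + ext y (rk i) else 0)) => [y i|i].
  by rewrite mxE.
case: (i \in A) => y; last exact: cst_continuous.
have c := @continuous_ext n (rk i) y.
by apply: (cvgD _ c); exact: cvg_cst.
Qed.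

Let continuous_embV : continuous embV.
Proof.
apply: (@continuous_row R 'rV[R]_4 n embV
  (fun i x => x ord0 (pt (lift ord0 i)) - n.+1%:R^-1)) => [y i|i x].
  by rewrite mxE.
have c := @coord_continuous R 1 4 ord0 (pt (lift ord0 i)) x.
by apply: (cvgB c); exact: cvg_cst.
Qed.

(** The radial homeomorphism from the round ball to the gauge ball is followed by the affine map
    onto the face. Interiors correspond because the radial map carries one gauge to the other. *)
Lemma closed_face_chart : exists chi : 'rV[R]_n -> 'rV[R]_4,
  homeo_on (@euclidean_closed_ball R n) (closed_face A) chi /\
  chi @` @euclidean_open_ball R n = @open_face R A.
Proof.
have [phi [hphi gphi]] := homeo_on_gauge_ball (@gauge_enorm R n)
  (@gauge_simplex n).
have hemb : homeo_on [set y | simplex_gauge y <= 1] (closed_face A) emb.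
  split; first exact: continuous_subspaceT.
  exists embV; split => //; first exact: continuous_subspaceT.
  - by move=> y /emb_range.
  - by move=> x Ax; apply/emb_range; rewrite embVK.
exists (emb \o phi); rewrite euclidean_closed_ballE euclidean_open_ballE.
have hc := homeo_on_comp hphi hemb; split => //.
apply/seteqP; split => [_ [y /= y1 <-]|x Ax].
  by apply/emb_interior; rewrite gphi.
have [y y1 yx] : ((emb \o phi) @` [set y | enorm y <= 1]) x.
  by rewrite (homeo_on_image hc); exact: sub_open_closed_face.
by exists y => //=; rewrite -gphi; apply/emb_interior; rewrite -yx in Ax.
Qed.

End Embedding.
End SimplexChart.

Section Faces.
Context {R : realType}.
Implicit Types A B : {set 'I_4}.

Definition barycenter A : 'rV[R]_4 :=
  \row_i (if i \in A then #|A|%:R^-1 else 0).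

Lemma open_face_barycenter A : A != finset.set0 -> open_face A (barycenter A).
Proof.
move=> A0; have cA : (0 < #|A|)%N by rewrite card_gt0.
split => [|i|i]; last 2 first.
- by rewrite mxE => ->; rewrite invr_gt0 ltr0n.
- by rewrite mxE => /negPf ->.
rewrite (bigID (mem A)) /= [X in _ + X]big1 ?addr0; last first.
  by move=> i /negPf iA; rewrite mxE iA.
rewrite (eq_bigr (fun=> #|A|%:R^-1)) => [|i iA]; last by rewrite mxE iA.
by rewrite sumr_const -(mulr_natr #|A|%:R^-1) mulVf // pnatr_eq0 -lt0n.
Qed.

Lemma open_face_inj A B (x : 'rV[R]_4) :
  open_face A x -> open_face B x -> A = B.
Proof.
move=> [_ Ax A0] [_ Bx B0]; apply/setP => i.
case: (boolP (i \in A)) (Ax i) (A0 i) => _ a a0;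
  case: (boolP (i \in B)) (Bx i) (B0 i) => _ b b0 //.
  by have := a isT; rewrite b0 ?ltxx.
by have := b isT; rewrite a0 ?ltxx.
Qed.

Lemma open_face_neq0 A (x : 'rV[R]_4) : open_face A x -> A != finset.set0.
Proof.
move=> [s1 _ x0]; apply/eqP => A0; move: s1.
by rewrite big1 => [/eqP|i _]; [rewrite eq_sym oner_eq0|rewrite x0 // A0 inE].
Qed.

Lemma open_face_supp (x : 'rV[R]_4) A : closed_face A x ->
  exists B, [/\ B \subset A, open_face B x & B != finset.set0].
Proof.
move=> [s1 x_ge0 x0]; pose B := [set i | 0 < x ord0 i]%SET.
have Bx : open_face B x.
  split => // i; rewrite inE // -leNgt => xi.
  by apply/eqP; rewrite eq_le xi x_ge0.
exists B; split => //; last exact: open_face_neq0 Bx.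
apply/fintype.subsetP => i; rewrite inE.
by apply: contraTT => /x0 ->; rewrite ltxx.
Qed.

Lemma closed_faceS A B : A \subset B -> closed_face A `<=` @closed_face R B.
Proof.
move=> /fintype.subsetP AB x [s1 x_ge0 x0]; split => // i iB; apply: x0.
by apply: contra iB; exact: AB.
Qed.

Lemma closed_closed_face A : closed (@closed_face R A).
Proof.
have cc i := @coord_continuous R 1 4 ord0 i.
have pc (f : 'rV[R]_4 -> R) (D : set R) : continuous f -> closed D ->
    closed [set x | D (f x)].
  by move=> cf; exact: (@preimage_closed _ _ f D (fun x _ => cf x)).
have c0 (i : 'I_4) : closed [set x : 'rV[R]_4 | 0 <= x ord0 i].
  exact: (pc _ _ (cc i) (@closed_ge R 0)).
have ce (i : 'I_4) : closed [set x : 'rV[R]_4 | x ord0 i = 0].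
  exact: (pc _ _ (cc i) (@closed_eq R 0)).
have cs : closed [set x : 'rV[R]_4 | \sum_(i < 4) x ord0 i = 1].
  have c1 : continuous (fun x : 'rV[R]_4 => \sum_(i < 4) x ord0 i).
    by apply: continuous_sum => i _; exact: cc.
  exact: (pc _ _ c1 (@closed_eq R 1)).
have -> : @closed_face R A =
    [set x : 'rV[R]_4 | \sum_(i < 4) x ord0 i = 1] `&`
    \bigcap_(i in [set: 'I_4]) [set x : 'rV[R]_4 | 0 <= x ord0 i] `&`
    \bigcap_(i in [set i : 'I_4 | i \notin A])
      [set x : 'rV[R]_4 | x ord0 i = 0].
  apply/seteqP; split => [x [s1 h0 hA]|x [[s1 h0] hA]]; last first.
    by split => // i; exact: h0.
  by split; [split => // i _; exact: h0|move=> i; exact: hA].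
apply: closedI; first apply: closedI => //.
  by apply: closed_bigI => i _; exact: c0.
by apply: closed_bigI => i _; exact: ce.
Qed.

(** A point of the closed face is approached along the segment towards the barycenter, which runs
    inside the open face once it has left its starting point. *)
Lemma closure_open_face A : closure (@open_face R A) = closed_face A.
Proof.
apply/seteqP; split => [|x Ax].
  rewrite (closure_id (closed_face A)).1; last exact: closed_closed_face.
  exact/closureS/sub_open_closed_face.
have [B [BA xB B0]] := open_face_supp Ax.
have A0 : A != finset.set0.
  by apply: contraNneq B0 => e; rewrite e finset.subset0 in BA.
have [s1 x_ge0 x0] := Ax; have [b1 b_gt0 b0] := open_face_barycenter A0.
pose z (t : R) := x + t *: (barycenter A - x).
have cz : z t @[t --> 0] --> x.
  rewrite -[X in _ --> X]addr0 -(scale0r (barycenter A - x)).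
  by apply: cvgD; [exact: cvg_cst|apply: cvgZr_tmp; exact: cvg_id].
move=> W nW.
have [t /= [[t_gt0 t_lt1] Wt]] := filter_ex (filterI (filterI
  (nbhs_right_gt 0) (nbhs_right_lt ltr01)) (cvg_at_right_filter cz nW)).
have zE i : z t ord0 i = (1 - t) * x ord0 i + t * barycenter A ord0 i.
  by rewrite !mxE; ring.
exists (z t); split => //; split => [|i iA|i iA].
- under eq_bigr do rewrite zE.
  by rewrite big_split /= -!mulr_sumr s1 b1; ring.
- rewrite zE ltr_wpDl ?mulr_ge0 ?subr_ge0 ?(ltW t_lt1) //.
  by rewrite mulr_gt0 // b_gt0.
- by rewrite zE x0 // b0 // !mulr0 addr0.
Qed.

End Faces.

(** * The solid tetrahedron as a regular complex *)

(** [a0] only supplies the value of the inverse outside [A]. *)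
Lemma homeo_on_set_val (T : topologicalType) (A : set T) (a0 : set_type A) :
  homeo_on [set: set_type A] A set_val.
Proof.
split; first by apply: continuous_subspaceT; exact: initial_continuous.
pose g (y : T) : set_type A :=
  if pselect (A y) is left Ay then exist _ y (mem_set Ay) else a0.
have gK x : g (set_val x) = x.
  rewrite /g; case: pselect => [Ax|[]]; last exact: set_valP.
  by apply/val_inj; rewrite /= set_valE.
have vK y : A y -> set_val (g y) = y.
  by move=> Ay; rewrite /g; case: pselect => // Ay'; rewrite set_valE.
exists g; split => // [|x _]; last exact: set_valP.
apply/subspace_sigL_continuousP.
have -> : sigL A g = id by apply/funext => x; rewrite /= -[RHS]gK.
by move=> x; exact: cvg_id.
Qed.

Lemma hausdorff_set_type (T : topologicalType) (A : set T) :
  hausdorff_space T -> hausdorff_space (set_type A).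
Proof.
rewrite !open_hausdorff => hT x y xy.
have : set_val x != set_val y.
  by apply: contra_neq xy; rewrite !set_valE => /val_inj.
move=> /hT[[U V]] /= [xU yV] [oU oV UV].
exists (set_val @^-1` U, set_val @^-1` V) => /=.
  by rewrite !inE /=; split; exact/set_mem.
split; [by exists U|by exists V|].
by rewrite -preimage_setI (eqP UV) preimage_set0.
Qed.

Section Model.
Context {R : realType}.
Implicit Types A B : {set 'I_4}.

Let Delta := @closed_face R [set: 'I_4]%SET.

Lemma sub_open_face_simplex A : @open_face R A `<=` Delta.
Proof.
apply: subset_trans (@sub_open_closed_face R A) _.
exact/closed_faceS/finset.subsetT.
Qed.

Let center : set_type Delta.
Proof.
exists (barycenter [set: 'I_4]%SET); apply: mem_set.
apply: sub_open_face_simplex; apply: open_face_barycenter.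
by apply/eqP => /setP/(_ ord0); rewrite !inE.
Qed.

(** The empty set is excluded because its open face is empty, whereas cells are nonempty. *)
Definition label_type : finType := {A : {set 'I_4} | A != finset.set0}.

Definition simplex_cell (v : label_type) : set (set_type Delta) :=
  set_val @^-1` @open_face R (val v).

Lemma card_label (v : label_type) : #|val v| = (#|val v|.-1).+1.
Proof. by case: v => A A0 /=; rewrite prednK // card_gt0. Qed.

Lemma homeo_on_simplex : homeo_on [set: set_type Delta] Delta set_val.
Proof. exact: homeo_on_set_val center. Qed.

Lemma image_simplex_cell v : set_val @` simplex_cell v = @open_face R (val v).
Proof.
apply/seteqP; split => [_ [x xv <-] //|y yv].
have : (set_val @` [set: set_type Delta]) y.
  by rewrite (homeo_on_image homeo_on_simplex); exact: sub_open_face_simplex yv.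
by move=> [x _ xy]; exists x => //; rewrite /simplex_cell /= xy.
Qed.

Lemma closure_simplex_cell v :
  closure (simplex_cell v) = set_val @^-1` @closed_face R (val v).
Proof.
apply/predeqP => x.
rewrite (homeo_on_closure homeo_on_simplex) // image_simplex_cell.
by rewrite closure_open_face.
Qed.

Lemma simplex_boundary_cell v : cell_boundary (simplex_cell v) =
  \bigcup_(w in [set` [set w : label_type | val w \proper val v]%SET])
    simplex_cell w.
Proof.
rewrite /cell_boundary closure_simplex_cell.
apply/seteqP; split => [x [/= /open_face_supp[B [BA xB B0]] xv]|x [w]].
  exists (exist _ B B0) => //=; rewrite inE /= finset.properEneq BA andbT.
  by apply: contra_notN xv => /eqP; rewrite /simplex_cell /= => <-.
rewrite /= inE => wv xw; split; last first.
  by move=> xv; move: wv; rewrite (open_face_inj xw xv) fintype.properxx.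
by apply: closed_faceS (proper_sub wv) _ _; exact: sub_open_closed_face.
Qed.

Lemma simplex_characteristic_map (v : label_type) :
  exists chi : 'rV[R]_(#|val v|.-1) -> set_type Delta,
    homeo_on (@euclidean_closed_ball R _) (closure (simplex_cell v)) chi /\
    chi @` @euclidean_open_ball R _ = simplex_cell v.
Proof.
have [chi [hchi chi_open]] := @closed_face_chart R _ _ (card_label v).
have [g [hg gK vK]] := homeo_on_inverse homeo_on_simplex.
have hg' : homeo_on (closed_face (val v)) (closure (simplex_cell v)) g.
  rewrite closure_simplex_cell; apply: homeo_on_subset hg => //.
    exact/closed_faceS/finset.subsetT.
  by move=> y /vK /= ->.
exists (g \o chi); split; first exact: homeo_on_comp hchi hg'.
rewrite -image_comp chi_open -image_simplex_cell image_comp.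
apply/seteqP; split => [_ [x xv <-]|x xv]; first by rewrite /= gK.
by exists x => //=; exact: gK.
Qed.

Lemma simplex_cells_cover :
  \bigcup_(v in [set: label_type]) simplex_cell v = [set: set_type Delta].
Proof.
apply/seteqP; split => // x _.
have [B [_ xB B0]] := open_face_supp (set_valP x).
by exists (exist _ B B0).
Qed.

Lemma simplex_cells_disjoint (v w : label_type) : v != w ->
  simplex_cell v `&` simplex_cell w = set0.
Proof.
move=> vw; apply/seteqP; split => // x [xv xw]; case/eqP: vw.
by apply/val_inj; exact: open_face_inj xv xw.
Qed.

Lemma simplex_boundary_subcomplex (v : label_type) :
  exists D : {set label_type},
    [/\ cell_boundary (simplex_cell v) = \bigcup_(w in [set` D]) simplex_cell w,
        forall w, w \in D -> (#|val w|.-1 < #|val v|.-1)%N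
      & forall w, w \in D ->
          closure (simplex_cell w) `<=` \bigcup_(u in [set` D]) simplex_cell u].
Proof.
exists [set w : label_type | val w \proper val v]%SET.
split => [|w|w]; first exact: simplex_boundary_cell.
  by rewrite inE => /proper_card; rewrite [in X in X -> _]card_label
       [in X in X -> _](card_label v).
rewrite inE closure_simplex_cell => wv x /= /open_face_supp[B [BA xB B0]].
exists (exist _ B B0) => //=; rewrite inE.
exact: fintype.sub_proper_trans BA wv.
Qed.

Definition simplex_complex : regular_complex R :=
  @RegularComplex R (set_type Delta) label_type simplex_cell
    (fun v => #|val v|.-1)
    (hausdorff_set_type (@norm_hausdorff R 'rV[R]_4))
    simplex_cells_cover simplex_cells_disjoint simplex_characteristic_map
    simplex_boundary_subcomplex.

End Model.

(** * Labelling the cells of a solid tetrahedron *)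

Section RegularComplex.
Context {R : realType} (C : regular_complex R).
Implicit Types v w : bary C.

Lemma cell_nonempty v : cell v !=set0.
Proof.
have [chi [_ chi_open]] := characteristic_map v.
exists (chi 0); rewrite -chi_open; exists 0 => //=.
rewrite /euclidean_open_ball /= big1 ?ltr01 // => i _.
by rewrite mxE expr0n.
Qed.

Lemma cell_eq v w x : cell v x -> cell w x -> v = w.
Proof.
move=> vx wx; apply/eqP; apply: contraT => /cells_disjoint vw.
by have : (cell v `&` cell w) x by []; rewrite vw.
Qed.

Lemma cell_of (x : C) : exists v, cell v x.
Proof.
have : [set: C] x by []; rewrite -(cells_cover C) => -[v _ vx].
by exists v.
Qed.

Lemma connected_euclidean_open_ball (n : nat) :
  connected (@euclidean_open_ball R n).
Proof.
(* The ball is star-shaped: it is a union of segments issuing from the origin. *)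
pose seg (x : 'rV[R]_n) := (fun t : R => t *: x) @` `[0, 1].
have -> : @euclidean_open_ball R n =
    \bigcup_(x in @euclidean_open_ball R n) seg x.
  rewrite euclidean_open_ballE; apply/seteqP; split => [x x1|y [x /= x1]].
    by exists x => //; exists 1; rewrite ?scale1r //= in_itv /= ler01 lexx.
  move=> [t]; rewrite /= in_itv /= => /andP[t0 t1] <-.
  have [_ eZ _ _] := @gauge_enorm R n; rewrite eZ //.
  by apply: le_lt_trans x1; rewrite ler_piMl // sqrtr_ge0.
apply: bigcup_connected => [|x _].
  exists 0 => x _; exists 0; rewrite ?scale0r //= in_itv /= ler01 lexx //.
apply: connected_continuous_connected; first exact: segment_connected.
apply: continuous_subspaceT => t.
by apply: cvgZr_tmp; exact: cvg_id.
Qed.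

Lemma connected_cell v : connected (cell v).
Proof.
have [chi [[cchi _] <-]] := characteristic_map v.
apply: connected_continuous_connected.
  exact: connected_euclidean_open_ball.
by apply: continuous_subspaceW cchi => x /ltW.
Qed.

End RegularComplex.

Section Labelling.
Context {R : realType}.

(** [h] says nothing about the 3-cell; labelling that cell by the full vertex set makes inclusion of
    labels the face relation among all cells. *)
Definition tetra_labelling (C : regular_complex R) (O : bary C)
    (h : C -> 'rV[R]_4) (lab : bary C -> {set 'I_4}) : Prop :=
  [/\ cdim O = 3%N, closure (cell O) = [set: C],
      homeo_on (cell_boundary (cell O)) (@tetrahedron_boundary R) h,
      lab O = [set: 'I_4]%SET
    & forall v, v != O ->
        #|lab v| = (cdim v).+1 /\ h @` cell v = @open_face R (lab v)].

Lemma solid_tetrahedron_labelling (C : regular_complex R) :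
  solid_tetrahedron C -> exists O h lab, @tetra_labelling C O h lab.
Proof.
move=> [] O [dimO clO [h [hh hlab]]].
have /choice[lab labP] : forall v : bary C, exists A : {set 'I_4},
    (v = O -> A = [set: 'I_4]%SET) /\ (v != O ->
    #|A| = (cdim v).+1 /\ h @` cell v = @open_face R A).
  move=> v; have [->|vO] := eqVneq v O; first by exists [set: 'I_4]%SET.
  by have [A hA] := hlab v vO; exists A; split => // e; rewrite e eqxx in vO.
exists O, h, lab; split => // [|v vO]; first exact: (labP O).1.
exact: (labP v).2.
Qed.

Section LabellingTheory.
Variables (C : regular_complex R) (O : bary C) (h : C -> 'rV[R]_4).
Variable lab : bary C -> {set 'I_4}.
Hypothesis L : tetra_labelling O h lab.
Implicit Types v w : bary C.

Lemma card_lab v : #|lab v| = (cdim v).+1.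
Proof.
case: L => dimO _ _ labO labP.
have [->|/labP[]//] := eqVneq v O.
by rewrite labO dimO cardsT card_ord.
Qed.

Lemma boundary_top x : cell_boundary (cell O) x <-> ~ cell O x.
Proof.
by case: L => _ clO _ _ _; rewrite /cell_boundary clO; split => // -[].
Qed.

Lemma sub_boundary_top v : v != O -> cell v `<=` cell_boundary (cell O).
Proof.
by move=> vO x vx; apply/boundary_top => /(cell_eq vx) e; rewrite e eqxx in vO.
Qed.

Lemma lab_point v x : v != O -> cell v x -> @open_face R (lab v) (h x).
Proof. by case: L => _ _ _ _ labP /labP[_ <-] vx; exists x. Qed.

Lemma lab_neqT v : v != O -> lab v != [set: 'I_4]%SET.
Proof.
move=> vO; have [x vx] := cell_nonempty v.
have := sub_boundary_top vO vx; case: L => _ _ hh _ _ bx.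
have : tetrahedron_boundary (h x) by rewrite -(homeo_on_image hh); exists x.
move=> [A /= AT Ax]; apply: contraTneq AT => e.
by rewrite negbK (open_face_inj Ax (lab_point vO vx)) e.
Qed.

Lemma lab_eqT v : (lab v == [set: 'I_4]%SET) = (v == O).
Proof.
have [->|/lab_neqT/negPf //] := eqVneq v O.
by case: L => _ _ _ -> _; rewrite eqxx.
Qed.

Lemma lab_neq0 v : lab v != finset.set0.
Proof. by rewrite -card_gt0 card_lab. Qed.

Lemma lab_inj : injective lab.
Proof.
move=> v w e; have [wO|wO] := eqVneq w O.
  by apply/eqP; rewrite wO -lab_eqT e wO lab_eqT.
have vO : v != O by rewrite -lab_eqT e lab_eqT.
case: (L) => _ _ hh _ labP; have [_ hv] := labP v vO; have [_ hw] := labP w wO.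
have [x vx] := cell_nonempty v.
have [y wy xy] : (h @` cell w) (h x) by rewrite hw -e -hv; exists x.
suff e' : y = x by apply: cell_eq vx _; rewrite -e'.
apply: (homeo_on_inj hh) xy; first exact: sub_boundary_top wy.
exact: sub_boundary_top vx.
Qed.

(** The barycenter of a proper face is the image of a boundary point, and the cell of that point
    carries the label [A]. *)
Lemma lab_surj A : A != finset.set0 -> exists v, lab v = A.
Proof.
move=> A0; case: (L) => _ _ hh labO _.
have [->|AT] := eqVneq A [set: 'I_4]%SET; first by exists O.
have Ab := @open_face_barycenter R A A0.
have : (h @` cell_boundary (cell O)) (barycenter A).
  by rewrite (homeo_on_image hh); exists A => //=; exact/eqP.
move=> [x bx xA]; have [v vx] := cell_of x.
have vO : v != O.
  by apply/eqP => e; move/boundary_top: bx; apply; rewrite -e.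
by exists v; apply: open_face_inj (lab_point vO vx) _; rewrite xA.
Qed.

(** On the boundary, [h] turns closures of cells into closed faces of the simplex. That the closure
    of a boundary cell avoids the 3-cell comes from the subcomplex axiom for [O]. *)
Lemma closure_cell_lab v w x : cell w x ->
  closure (cell v) x <-> lab w \subset lab v.
Proof.
move=> wx; have [dimO clO hh labO labP] := L.
have [->|vO] := eqVneq v O; first by rewrite clO labO finset.subsetT.
have [D [bD dimD clD]] := boundary_subcomplex O.
have vD : v \in D.
  have [y vy] := cell_nonempty v.
  by have := sub_boundary_top vO vy; rewrite bD => -[u /= uD /(cell_eq vy) ->].
have clv : closure (cell v) `<=` cell_boundary (cell O).
  by rewrite bD; exact: clD vD.
have [wO|wO] := eqVneq w O.
  subst w; rewrite labO finset.subTset; split; first by move/clv/boundary_top.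
  by rewrite (negPf (lab_neqT vO)).
have bx := sub_boundary_top wO wx.
rewrite (homeo_on_closure hh (sub_boundary_top vO) bx).
rewrite (labP v vO).2 closure_open_face; split.
  move=> /open_face_supp[B [BA Bx _]].
  by rewrite (open_face_inj (lab_point wO wx) Bx).
move=> wv; apply: closed_faceS wv _ _; apply: sub_open_closed_face.
exact: lab_point.
Qed.

Lemma boundary_cell_lab v w x : cell w x ->
  cell_boundary (cell v) x <-> lab w \proper lab v.
Proof.
move=> wx; rewrite /cell_boundary finset.properEneq; split.
  move=> [/(closure_cell_lab _ wx) -> vx]; rewrite andbT.
  by apply: contra_notN vx => /eqP/lab_inj <-.
move=> /andP[wv /(closure_cell_lab _ wx) clx]; split => // vx.
by rewrite (cell_eq wx vx) eqxx in wv.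
Qed.

Lemma sub_boundary_cell_lab v w :
  cell w `<=` cell_boundary (cell v) <-> lab w \proper lab v.
Proof.
split => [wv|wv x wx]; last exact/(boundary_cell_lab v wx).
by have [x wx] := cell_nonempty w; apply/(boundary_cell_lab v wx)/wv.
Qed.

End LabellingTheory.
End Labelling.

(** * Renumbering vertices, and extending boundary homeomorphisms over the 3-cell *)

Section Extension.
Context {R : realType}.

(** The inverse permutation in the coordinates makes vertex [i] go to vertex [s i]. *)
Definition permute_coord (s : {perm 'I_4}) (x : 'rV[R]_4) : 'rV[R]_4 :=
  \row_i x ord0 (s^-1%g i).

Lemma permute_coordK (s : {perm 'I_4}) :
  cancel (permute_coord s) (permute_coord s^-1%g).
Proof. by move=> x; apply/rowP => i; rewrite !mxE invgK permK. Qed.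

Lemma permute_open_face (s : {perm 'I_4}) A x :
  open_face A x -> open_face (s @: A) (permute_coord s x).
Proof.
move=> [s1 x_gt0 x0]; split => [|i /imsetP[j jA ->]|i iA].
- rewrite -s1 [RHS](reindex_inj (@perm_inj _ s^-1%g)).
  by apply: eq_bigr => i _; rewrite mxE.
- by rewrite mxE permK x_gt0.
- rewrite mxE x0 //; apply: contra iA => iA; apply/imsetP.
  by exists (s^-1%g i) => //; rewrite permKV.
Qed.

Lemma imset_permK (s : {perm 'I_4}) (A : {set 'I_4}) :
  (s^-1)%g @: (s @: A) = A.
Proof.
rewrite -imset_comp (eq_imset (g := id)) ?imset_id // => i /=; exact: permK.
Qed.

Lemma image_permute_open_face (s : {perm 'I_4}) A :
  permute_coord s @` @open_face R A = @open_face R (s @: A).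
Proof.
apply/seteqP; split => [_ [x xA <-]|x xA]; first exact: permute_open_face.
exists (permute_coord s^-1%g x).
  by have := permute_open_face s^-1%g xA; rewrite imset_permK.
by have := permute_coordK s^-1%g x; rewrite invgK.
Qed.

Lemma continuous_permute_coord (s : {perm 'I_4}) : continuous (permute_coord s).
Proof.
apply: (@continuous_row R 'rV[R]_4 4 _ (fun i x => x ord0 (s^-1%g i))).
  by move=> x i; rewrite mxE.
by move=> i; exact: coord_continuous.
Qed.

Lemma permute_tetrahedron_boundary (s : {perm 'I_4}) x :
  tetrahedron_boundary x -> @tetrahedron_boundary R (permute_coord s x).
Proof.
move=> [A /= AT xA]; exists (s @: A); last exact: permute_open_face.
apply: contra AT => /eqP sA; rewrite -(imset_permK s A) sA.
by apply/eqP/setP => i; rewrite inE; apply/imsetP; exists (s i); rewrite ?permK.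
Qed.

(** The symmetries of the simplex act on labellings, so the vertices can later be renumbered along
    an orientation. *)
Lemma relabelling (C : regular_complex R) (O : bary C) h lab s :
  tetra_labelling O h lab ->
  tetra_labelling O (permute_coord s \o h)
    (fun v => (s : {perm 'I_4}) @: lab v).
Proof.
move=> [dimO clO hh labO labP]; split => //.
- apply: homeo_on_comp hh _; split.
    by apply: continuous_subspaceT; exact: continuous_permute_coord.
  exists (permute_coord s^-1%g).
  split => [|x|x|x _|x _].
  + by apply: continuous_subspaceT; exact: continuous_permute_coord.
  + exact: permute_tetrahedron_boundary.
  + exact: permute_tetrahedron_boundary.
  + exact: permute_coordK.
  + by have := permute_coordK s^-1%g x; rewrite invgK.
- rewrite labO; apply/setP => i; rewrite inE; apply/imsetP.
  by exists (s^-1%g i); rewrite ?permKV.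
- move=> v /labP[cv hv]; split.
    by rewrite card_imset //; exact: perm_inj.
  by rewrite -image_comp hv image_permute_open_face.
Qed.

(** The open ball fills the cell exactly, so the unit sphere is left for the cell boundary. *)
Lemma boundary_chart (C : regular_complex R) (v : bary C) :
  cdim v = 3%N -> exists chi : 'rV[R]_3 -> C,
    [/\ homeo_on [set y | enorm y <= 1] (closure (cell v)) chi,
        homeo_on [set y | enorm y = 1] (cell_boundary (cell v)) chi
      & forall y, enorm y <= 1 -> cell v (chi y) <-> enorm y < 1].
Proof.
move=> dimv; have := characteristic_map v; rewrite dimv.
rewrite euclidean_closed_ballE euclidean_open_ballE => -[chi [hchi chi_open]].
have vchi y : enorm y <= 1 -> cell v (chi y) <-> enorm y < 1.
  move=> y1; rewrite -chi_open; split; last by exists y.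
  move=> [z /= z1]; move/(homeo_on_inj hchi (ltW z1) y1) => <- //.
exists chi; split => //; apply: (homeo_on_subset _ _ _ hchi).
- by move=> y /= ->.
- by move=> x [].
- move=> y /= y1; rewrite /cell_boundary /=; split => [y1'|[_ vy]].
    split; last by rewrite vchi // y1' ltxx.
    by rewrite -(homeo_on_image hchi); exists y.
  by apply/eqP; rewrite eq_le y1 leNgt; apply/negP => /(vchi _ y1).
Qed.

Lemma label_bijection (C C' : regular_complex R) (O : bary C) (O' : bary C')
    h h' lab lab' :
  tetra_labelling O h lab -> tetra_labelling O' h' lab' ->
  exists phi : bary C -> bary C',
    bijective phi /\ forall v, lab' (phi v) = lab v.
Proof.
move=> L L'.
have /choice[phi phiP] v := lab_surj L' (lab_neq0 L v).
have /choice[psi psiP] v := lab_surj L (lab_neq0 L' v).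
exists phi; split => //; exists psi => v.
  by apply: (lab_inj L); rewrite psiP phiP.
by apply: (lab_inj L'); rewrite phiP psiP.
Qed.

Lemma labelling_iso (C C' : regular_complex R) (O : bary C) (O' : bary C')
    h h' lab lab' :
  tetra_labelling O h lab -> tetra_labelling O' h' lab' ->
  exists (f : C -> C') (phi : bary C -> bary C'),
    [/\ homeo_on [set: C] [set: C'] f, bijective phi,
        forall v, cdim (phi v) = cdim v /\ f @` cell v = cell (phi v)
      & forall v, lab' (phi v) = lab v].
Proof.
move=> L L'; have [phi [phi_bij phiP]] := label_bijection L L'.
have [dimO clO hh labO labP] := L; have [dimO' clO' hh' labO' labP'] := L'.
have [chi [hchi bchi ochi]] := boundary_chart dimO.
have [chi' [hchi' bchi' ochi']] := boundary_chart dimO'.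
rewrite clO in hchi; rewrite clO' in hchi'.
have [g [hg gK h'K]] := homeo_on_inverse hh'.
have [k [hk kK chi'K]] := homeo_on_inverse bchi'.
have [l [hl lK chiK]] := homeo_on_inverse hchi.
(* The self-homeomorphism of the unit sphere induced by the two labellings and the two
   characteristic maps. *)
have hphi0 := homeo_on_comp (homeo_on_comp (homeo_on_comp bchi hh) hg) hk.
have [hPhi ePhi] := homeo_on_cone (@gauge_enorm R 3) (@gauge_enorm R 3) hphi0.
set Phi := cone _ _ in hPhi ePhi.
have hf := homeo_on_comp (homeo_on_comp hl hPhi) hchi'.
exists (chi' \o (Phi \o l)), phi; split => //.
have phiO : phi O = O'.
  by apply: (lab_inj L'); rewrite phiP labO labO'.
have l_ball x : enorm (l x) <= 1.
  have : (l @` [set: C]) (l x) by exists x.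
  by rewrite (homeo_on_image hl).
(* The cone preserves the Euclidean norm, hence the open ball, hence the 3-cells correspond. *)
have fO x : cell O' ((chi' \o (Phi \o l)) x) <-> cell O x.
  rewrite /= ochi' ?ePhi ?l_ball // -{2}(chiK x) //; symmetry.
  exact/ochi/l_ball.
(* On the unit sphere the cone is the given sphere map, so the characteristic maps cancel and only
   [h] followed by the inverse of [h'] is left, which matches cells by labels. *)
have fb x : cell_boundary (cell O) x -> (chi' \o (Phi \o l)) x = g (h x).
  move=> bx; have [y y1 xy] : (chi @` [set y | enorm y = 1]) x.
    by rewrite (homeo_on_image bchi).
  rewrite -xy /= lK /=; last by rewrite y1.
  rewrite /Phi cone_sphere //= chi'K // -(homeo_on_image hg).
  exists (h (chi y)) => //; rewrite -(homeo_on_image hh).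
  by exists (chi y) => //; rewrite xy.
move=> v; split.
  by apply/eqP; rewrite -eqSS -(card_lab L') -(card_lab L) phiP.
have [->|vO] := eqVneq v O.
  rewrite phiO; apply/seteqP; split => [_ [x /fO xO <-] //|z zO].
  have [x _ xz] : ((chi' \o (Phi \o l)) @` [set: C]) z.
    by rewrite (homeo_on_image hf).
  by exists x => //; apply/fO; rewrite xz.
have vO' : phi v != O' by rewrite -phiO (inj_eq (bij_inj phi_bij)).
have bv := sub_boundary_top L vO; have bv' := sub_boundary_top L' vO'.
have E : h @` cell v = h' @` cell (phi v).
  by rewrite (labP v vO).2 (labP' _ vO').2 phiP.
apply/seteqP; split => [_ [x vx <-]|z vz].
  rewrite (fb _ (bv _ vx)); have [z vz <-] : (h' @` cell (phi v)) (h x).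
    by rewrite -E; exists x.
  by rewrite (gK _ (bv' _ vz)).
have [x vx xz] : (h @` cell v) (h' z) by rewrite E; exists z.
by exists x => //; rewrite (fb _ (bv _ vx)) xz (gK _ (bv' _ vz)).
Qed.

End Extension.

(** * Coding sets of vertices *)

Section VertexSets.
Local Open Scope nat_scope.
Implicit Types l : seq nat.

(* Coding subsets of 'I_4 by lists makes inclusion, equality and cardinality
   computable. *)
Definition vs l : {set 'I_4} := [set i : 'I_4 | val i \in l]%SET.

Lemma all_iota4 (P : pred nat) :
  reflect (forall i : 'I_4, P i) (all P (iota 0 4)).
Proof.
apply: (iffP allP) => [h i|h k]; first by apply: h; rewrite mem_iota ltn_ord.
by rewrite mem_iota => /= k4; exact: (h (Ordinal k4)).
Qed.

Definition subcode l l' : bool :=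
  all (fun k => (k \in l) ==> (k \in l')) (iota 0 4).

Lemma sub_vs l l' : (vs l \subset vs l') = subcode l l'.
Proof.
apply/fintype.subsetP/all_iota4 => h i.
  by apply/implyP; have := h i; rewrite !inE.
by rewrite !inE; exact/implyP/h.
Qed.

Lemma eq_vs l l' :
  (vs l == vs l') = all (fun k => (k \in l) == (k \in l')) (iota 0 4).
Proof.
apply/eqP/all_iota4 => [/setP h i|h]; first by have := h i; rewrite !inE => ->.
by apply/setP => i; rewrite !inE; have /eqP := h i.
Qed.

Lemma card_vs l : #|vs l| = count (mem l) (iota 0 4).
Proof.
rewrite -val_enum_ord enumT count_map cardE /enum_mem size_filter.
by apply: eq_count => i; rewrite /= !inE.
Qed.

Definition vertex_sets : seq (seq nat) :=
  [:: [::]; [:: 0]; [:: 1]; [:: 2]; [:: 3]; [:: 0; 1]; [:: 0; 2]; [:: 0; 3];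
      [:: 1; 2]; [:: 1; 3]; [:: 2; 3]; [:: 0; 1; 2]; [:: 0; 1; 3];
      [:: 0; 2; 3]; [:: 1; 2; 3]; [:: 0; 1; 2; 3]].

Lemma vs_surj (A : {set 'I_4}) : exists2 l, l \in vertex_sets & A = vs l.
Proof.
pose p k := [exists i : 'I_4, (val i == k) && (i \in A)].
exists [seq k <- iota 0 4 | p k].
  by rewrite /=; case: (p 0); case: (p 1); case: (p 2); case: (p 3).
apply/setP => i; rewrite inE mem_filter mem_iota leq0n ltn_ord !andbT.
rewrite {}/p; apply/idP/idP => [iA|].
  by apply/fintype.existsP; exists i; rewrite eqxx.
by move=> /fintype.existsP[j /andP[/eqP/val_inj <-]].
Qed.

Lemma all_vertex_sets (P : pred (seq nat)) (Q : {set 'I_4} -> Prop) :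
  (forall l, P l -> Q (vs l)) -> all P vertex_sets -> forall A, Q A.
Proof. by move=> PQ /allP h A; have [l /h/PQ hl ->] := vs_surj A. Qed.

Lemma vs_full : [set: 'I_4]%SET = vs [:: 0; 1; 2; 3].
Proof.
apply/eqP; rewrite finset.eqEsubset finset.subsetT andbT.
by apply/fintype.subsetP => -[[|[|[|[]]]]] // ? _; rewrite inE.
Qed.

Lemma vs0 : finset.set0 = vs [::].
Proof. by apply/setP => i; rewrite !inE. Qed.

Lemma vs1_inj i j : i < 4 -> vs [:: i] = vs [:: j] -> i = j.
Proof.
by move=> i4 /setP/(_ (Ordinal i4)); rewrite !inE eqxx => /esym/eqP.
Qed.

(** Serves as an eliminator: a claim about all edges becomes six closed instances that evaluate. *)
Lemma edge_ind (P : nat -> nat -> Prop) :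
  P 0 1 -> P 0 2 -> P 0 3 -> P 1 2 -> P 1 3 -> P 2 3 ->
  forall i j, i < j < 4 -> P i j.
Proof.
move=> ? ? ? ? ? ? i j /andP[+ j4].
by case: j j4 => [|[|[|[|]]]] // _; case: i => [|[|[|]]].
Qed.

Lemma edge_bounds i j : i < j < 4 -> [/\ i < 4, j < 4, i != j, i < 3 & 0 < j].
Proof. by elim/edge_ind. Qed.

Lemma vs2_inj i j i' j' : i < j < 4 -> i' < j' < 4 ->
  vs [:: i; j] = vs [:: i'; j'] -> i = i' /\ j = j'.
Proof.
move=> ij ij' /eqP; rewrite eq_vs.
by elim/edge_ind: ij; elim/edge_ind: ij'.
Qed.

Definition arcs (i : nat) (s : seq nat) : seq (seq nat) :=
  pairmap (fun a b => [:: a; b]) i s.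

(** The starting vertex 0 is omitted. A path is determined by which of 1 and 2 it visits. *)
Definition increasing_paths : seq (seq nat) :=
  [:: [:: 3]; [:: 1; 3]; [:: 2; 3]; [:: 1; 2; 3]].

Lemma path_ltn_from0_to3 s : path ltn 0 s -> last 0 s = 3 ->
  s \in increasing_paths.
Proof.
case: s => [|a [|b [|c [|d s]]]] //=.
- by rewrite andbT => a0 ->.
- by move=> /and3P[+ + _] b3; rewrite b3; case: a => [|[|[|[|]]]].
- move=> /and4P[+ + + _] c3; rewrite c3.
  by case: b => [|[|[|[|]]]] //; case: a => [|[|[|]]].
(* A fourth vertex after 0 would be at least 4, while the last vertex is 3. *)
move=> /and5P[a0 ab bc cd ds] e3.
have : d <= last d s.
  elim: s d ds {cd e3} => //= e s IH d /andP[de /IH].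
  by apply: leq_trans; exact: ltnW.
by rewrite e3; lia.
Qed.

End VertexSets.

(** * Presentations of templates *)

Section Presentation.
Context {R : realType}.

(** The open star, inside the boundary sphere, of the cell labelled [vs r]; hence the exclusion of
    the full label. *)
Definition star (C : regular_complex R) (lab : bary C -> {set 'I_4})
    (r : seq nat) : set C :=
  \bigcup_(v in [set v | (vs r \subset lab v) && (lab v != [set: 'I_4]%SET)])
    cell v.

Lemma starP (C : regular_complex R) (lab : bary C -> {set 'I_4}) r v x :
  cell v x ->
  star lab r x <-> (vs r \subset lab v) && (lab v != [set: 'I_4]%SET).
Proof. by move=> vx; split => [[w /= rw /(cell_eq vx) -> //]|rv]; exists v. Qed.

Definition ordered_edges (T : template_data R) (lab : bary T -> {set 'I_4}) :
    Prop :=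
  forall e : bary T, cdim e = 1%N -> exists i j : nat,
    [/\ (i < j < 4)%N, lab (src e) = vs [:: i], lab (tgt e) = vs [:: j]
      & lab e = vs [:: i; j]].

(* The vertices are numbered 0, 1, 2, 3 along the orientation; the meridians
   are given by their vertices after the North pole 0. *)
Definition presentation (T : template_data R) (O : bary T) (h : T -> 'rV[R]_4)
    (lab : bary T -> {set 'I_4}) (sWE sEW rW rE : seq nat) : Prop :=
  [/\ tetra_labelling O h lab,
      ordered_edges lab,
      lab (poleN T) = vs [:: 0%N] /\ lab (poleS T) = vs [:: 3],
      map lab (merWE T) = map vs (arcs 0 sWE) /\
      map lab (merEW T) = map vs (arcs 0 sEW)
    & hemW T = star lab rW /\ hemE T = star lab rE].

Definition presented (T : template_data R) (sWE sEW rW rE : seq nat) : Prop :=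
  exists O h lab, @presentation T O h lab sWE sEW rW rE.

(** All data are read off from labels, so the label-preserving homeomorphism respects them.
    Orientations agree because the label of an edge determines its smaller and larger end. *)
Lemma presented_iso (T T' : template_data R) sWE sEW rW rE :
  presented T sWE sEW rW rE -> presented T' sWE sEW rW rE -> template_iso T T'.
Proof.
move=> [top [h [lab [L o [pN pS] [mWE mEW] [hW hE]]]]].
move=> [top' [h' [lab' [L' o' [pN' pS'] [mWE' mEW'] [hW' hE']]]]].
have [f [phi [hf phi_bij phiP labphi]]] := labelling_iso L L'.
have inj' := lab_inj L'.
have stars r : f @` star lab r = star lab' r.
  apply/seteqP; split => [_ [x [v /= rv vx] <-]|y [w /= rw wy]].
    exists (phi v); first by rewrite /= labphi.
    by rewrite -(phiP v).2; exists x.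
  have [psi _ psiK] := phi_bij; have := wy; rewrite -{1}(psiK w) -(phiP _).2.
  by move=> [x xw xy]; exists x => //; exists (psi w); rewrite //= -labphi psiK.
exists f, phi; split => // [e e1|].
  have [i [j [ij si tj eij]]] := o e e1.
  have e1' : cdim (phi e) = 1%N by rewrite (phiP e).1.
  have [i' [j' [ij' si' tj' eij']]] := o' _ e1'.
  have [ii jj] : i' = i /\ j' = j by apply: vs2_inj; rewrite // -eij' -eij.
  by split; apply: inj'; rewrite labphi ?si ?tj ?si' ?tj' ?ii ?jj.
split.
- by split; apply: inj'; rewrite labphi ?pN ?pN' ?pS ?pS'.
- by apply: (inj_map inj'); rewrite -map_comp (eq_map labphi) mWE mWE'.
- by apply: (inj_map inj'); rewrite -map_comp (eq_map labphi) mEW mEW'.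
- by rewrite hW hW'.
- by rewrite hE hE'.
Qed.

Lemma presented_rho (T : template_data R) sWE sEW rW rE :
  presented T sWE sEW rW rE -> presented (rho T) sEW sWE rW rE.
Proof. by move=> [top [h [lab [L o p [mWE mEW] hem]]]]; exists top, h, lab. Qed.

Definition flip (l : seq nat) : seq nat := [seq (3 - k)%N | k <- l].

Let rev4 : {perm 'I_4} := perm (@rev_ord_inj 4).

(** The bound matters: an entry above 3 contributes nothing to [vs l], but truncated subtraction
    would turn it into vertex 0. *)
Lemma imset_rev_vs l : all (gtn 4) l -> rev4 @: vs l = vs (flip l).
Proof.
move=> /allP l4; apply/setP => i; rewrite [RHS]inE.
apply/imsetP/mapP => [[j]|[k kl ik]].
  by rewrite inE permE => jl ->; exists (val j).
by exists (Ordinal (l4 _ kl)); rewrite ?inE // permE; apply/val_inj.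
Qed.

(** Renumbering [i] as [3 - i] makes the reversed edges increasing again. The paths after reversal
    are supplied by the caller and compared with the reversed images of the old ones. *)
Lemma presented_kappa (T : template_data R) sWE sEW rW rE sWE' sEW' :
  all (gtn 4) rW -> all (gtn 4) rE ->
  map vs (arcs 0 sWE') = rev [seq rev4 @: vs l | l <- arcs 0 sEW] ->
  map vs (arcs 0 sEW') = rev [seq rev4 @: vs l | l <- arcs 0 sWE] ->
  presented T sWE sEW rW rE ->
  presented (kappa T) sWE' sEW' (flip rE) (flip rW).
Proof.
move=> rW4 rE4 eWE eEW [top [h [lab [L o [pN pS] [mWE mEW] [hW hE]]]]].
pose lab' (v : bary T) := rev4 @: lab v.
have stars r : all (gtn 4) r -> star lab r = star lab' (flip r).
  move=> r4; rewrite /star /lab' -imset_rev_vs //.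
  have E (A B : {set 'I_4}) : (rev4 @: A \subset rev4 @: B) = (A \subset B).
    apply/idP/idP => [/(imsetS rev4^-1%g)|/imsetS //].
    by rewrite !imset_permK.
  have ET (A : {set 'I_4}) :
      (rev4 @: A == [set: 'I_4]%SET) = (A == [set: 'I_4]%SET).
    rewrite -!finset.subTset -(E [set: 'I_4]%SET A).
    suff -> : rev4 @: [set: 'I_4]%SET = [set: 'I_4]%SET by [].
    apply/setP => i; rewrite inE; apply/imsetP.
    by exists (rev4^-1%g i); rewrite ?permKV.
  by apply: eq_bigcupl; split => v /=; rewrite E ET.
exists top, (permute_coord rev4 \o h), lab'; split.
- exact: relabelling.
- move=> e /o[i [j [/andP[ij j4] si tj eij]]]; exists (3 - j)%N, (3 - i)%N.
  split; first by lia.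
  + by rewrite /lab' tj imset_rev_vs //= j4.
  + by rewrite /lab' si imset_rev_vs //= (ltn_trans ij).
  rewrite /lab' eij imset_rev_vs /= ?j4 ?(ltn_trans ij) //.
  by apply/setP => k; rewrite !inE orbC.
- by rewrite /lab' pS pN !imset_rev_vs.
- have mlab (m : seq (bary T)) l : map lab m = map vs l ->
      map lab' m = [seq rev4 @: vs i | i <- l].
    move=> e.
    have -> : map lab' m = [seq rev4 @: (A : {set 'I_4}) | A <- map lab m].
      by rewrite -map_comp.
    by rewrite e -map_comp.
  by rewrite eWE eEW !map_rev (mlab _ _ mWE) (mlab _ _ mEW).
- by rewrite -!stars.
Qed.

End Presentation.

(** * Components of the complement of the meridians *)

(** In a separation of [B], the connected set [A] lies in one part; the other part then meets
    [closure A], against separatedness. *)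
Lemma connected_between (T : topologicalType) (A B : set T) :
  connected A -> A `<=` B -> B `<=` closure A -> connected B.
Proof.
move=> cA AB BA; apply/connectedP => E [E0 BE sE].
wlog AE : E E0 BE sE / A `<=` E false.
  move=> wl; have : A `<=` E false `|` E true by rewrite -BE.
  move=> /(connected_subset sE)/(_ cA)[]; first exact: wl.
  apply: (wl (E \o negb)) => /=; [by move=> b| by rewrite setUC|].
  by rewrite separatedC.
have [y Ey] := E0 true.
have : (closure (E false) `&` E true) y.
  by split => //; apply: (closureS AE); apply: BA; rewrite BE; right.
by case: sE => ->.
Qed.

Section Components.
Context {R : realType} (C : regular_complex R).
Variables (O : bary C) (h : C -> 'rV[R]_4) (lab : bary C -> {set 'I_4}).
Hypothesis L : tetra_labelling O h lab.
Implicit Types (M : set C) (v w : bary C).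

(** The central cell lies in the closure of each cell of the star, so their union is connected. Thus
    every point of the star is in the component of one point of the central cell. *)
Lemma star_component M r x : vs r != finset.set0 -> star lab r `<=` M ->
  star lab r x -> star lab r `<=` connected_component M x.
Proof.
move=> r0 rM rx; have [u ur] := lab_surj L r0; have [z uz] := cell_nonempty u.
have comp y : star lab r y -> connected_component M z y.
  move=> ry; have [v vy] := cell_of y.
  have /andP[rv vT] := (starP lab r vy).1 ry.
  exists (cell v `|` cell u); last by left.
  split; first by right.
    move=> t ut; apply: rM; case: ut => [vt|ut].
      by apply/(starP lab r vt)/andP.
    apply/(starP lab r ut); rewrite ur subxx; apply: contraNneq vT => rT.
    by rewrite -finset.subTset -rT.
  apply: (connected_between (@connected_cell R C v)); first by move=> t; left.
  move=> t [vt|ut]; first exact: subset_closure.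
  by apply/(closure_cell_lab L v ut); rewrite ur.
move=> y /comp zy; apply: connected_component_trans zy.
by apply: connected_component_sym; exact: comp.
Qed.

(** Finiteness of the complex enters here: a finite union of closed cells is closed. *)
Lemma closure_star r y w : closure (star lab r) y -> cell w y ->
  exists2 v, (vs r \subset lab v) && (lab v != [set: 'I_4]%SET) &
    lab w \subset lab v.
Proof.
move=> ry wy.
pose D := [set v | (vs r \subset lab v) && (lab v != [set: 'I_4]%SET)].
have clD : closed (\bigcup_(v in D) closure (cell v)).
  apply: closed_bigcup => [|v _]; first exact: finite_finset.
  exact: closed_closure.
have : (\bigcup_(v in D) closure (cell v)) y.
  rewrite ((closure_id _).1 clD); apply: closureS ry => t [v Dv vt].
  by exists v => //; exact: subset_closure.
by move=> [v Dv /(closure_cell_lab L v wy) wv]; exists v.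
Qed.

(** The combinatorial form of separatedness of two stars. *)
Definition incomparable_stars (r r' : seq nat) : Prop :=
  forall A B : {set 'I_4}, vs r \subset A -> A != [set: 'I_4]%SET ->
     vs r' \subset B -> B != [set: 'I_4]%SET ->
     ~~ (A \subset B) && ~~ (B \subset A).

Lemma star_separated r r' : incomparable_stars r r' ->
  separated (star lab r) (star lab r').
Proof.
move=> rr'; split; apply/seteqP; split => // y.
  move=> [ry [w /= /andP[rw wT] wy]].
  have [v /andP[rv vT] wv] := closure_star ry wy.
  by have := rr' _ _ rv vT rw wT; rewrite wv andbF.
move=> [[w /= /andP[rw wT] wy] ry].
have [v /andP[rv vT] wv] := closure_star ry wy.
by have := rr' _ _ rw wT rv vT; rewrite wv.
Qed.

Lemma star_is_component M r r' : vs r != finset.set0 ->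
  vs r != [set: 'I_4]%SET ->
  incomparable_stars r r' -> M = star lab r `|` star lab r' ->
  is_component M (star lab r).
Proof.
move=> r0 rT rr' eM; have [u ur] := lab_surj L r0.
have [x ux] := cell_nonempty u.
have rx : star lab r x by apply/(starP lab r ux); rewrite ur subxx.
have rM : star lab r `<=` M by rewrite eM => y; left.
exists x; first exact: rM.
apply/seteqP; split; first exact: star_component.
have sep := star_separated rr'.
have := @connected_component_sub _ M x; rewrite {2}eM.
move=> /(connected_subset sep)/(_ (@component_connected _ M x))[//|].
move=> /(_ x (connected_component_refl (rM _ rx))) r'x.
have : (star lab r `&` star lab r') x by [].
by rewrite (separated_disjoint sep).
Qed.

(** Each star is connected, hence inside one component. As [H] and [H'] are disjoint, nonempty and
    cover [M], each is exactly one star; which one is decided later by the directions of edges. *)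
Lemma component_stars M r r' H H' : vs r != finset.set0 ->
  vs r' != finset.set0 -> M = star lab r `|` star lab r' ->
  is_component M H -> is_component M H' -> H <> H' -> H `|` H' = M ->
  (H = star lab r /\ H' = star lab r') \/ (H = star lab r' /\ H' = star lab r).
Proof.
move=> r0 r'0 eM [x Mx eH] [y My eH'] HH' HHM.
have disj z : H z -> H' z -> False.
  rewrite eH eH' => /same_connected_component xz /same_connected_component yz.
  by apply: HH'; rewrite eH eH' xz.
have Hx : H x by rewrite eH; exact: connected_component_refl.
have H'y : H' y by rewrite eH'; exact: connected_component_refl.
wlog rx : r r' r0 r'0 eM / star lab r x.
  move=> wl; have := Mx; rewrite eM => -[rx|r'x]; first exact: wl.
  by rewrite or_comm; apply: wl => //; rewrite setUC.
have rM : star lab r `<=` M by rewrite eM => z; left.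
have r'M : star lab r' `<=` M by rewrite eM => z; right.
have rH : star lab r `<=` H by rewrite eH; exact: star_component.
have r'y : star lab r' y.
  have := My; rewrite eM => -[/rH Hy|//].
  by case: (disj y).
have rH' : star lab r' `<=` H' by rewrite eH'; exact: star_component.
left; split; apply/seteqP; split => // z Hz.
  have : M z by rewrite -HHM; left.
  by rewrite eM => -[//|/rH' /(disj _ Hz)].
have : M z by rewrite -HHM; right.
by rewrite eM => -[/rH/disj/(_ Hz)|].
Qed.

End Components.

(** * Meridians *)

Section Meridians.
Context {R : realType} (T : template_data R).
Variables (O : bary T) (h : T -> 'rV[R]_4) (lab : bary T -> {set 'I_4}).
Hypothesis L : tetra_labelling O h lab.
Implicit Types (v e : bary T).

Lemma lab_vertex v :
  cdim v = 0%N <-> exists2 i : nat, (i < 4)%N & lab v = vs [:: i].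
Proof.
have cv := card_lab L v; split => [v0|[i i4 vi]].
  move: cv; rewrite v0 => /eqP/cards1P[i vi].
  exists (val i); first exact: ltn_ord.
  by rewrite vi; apply/setP => j; rewrite !inE.
by move: cv; rewrite vi card_vs; case: i i4 {vi} => [|[|[|[|]]]] // _ [].
Qed.

Lemma lab_edge i j :
  (i < j < 4)%N -> exists2 e, cdim e = 1%N & lab e = vs [:: i; j].
Proof.
move=> ij4; have [|e eij] := lab_surj L (_ : vs [:: i; j] != finset.set0).
  by rewrite -card_gt0 card_vs; elim/edge_ind: ij4.
exists e => //; have := card_lab L e; rewrite eij card_vs.
by elim/edge_ind: ij4 {eij} => -[].
Qed.

Section Ordered.
Hypothesis ord : ordered_edges lab.

Lemma directed_path_arcs x p y i : (i < 4)%N -> lab x = vs [:: i] ->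
  directed_path x p y ->
  exists s, [/\ path ltn i s, lab y = vs [:: last i s]
              & map lab p = map vs (arcs i s)].
Proof.
elim: p x i => [|e p IH] x i i4 xi /=; first by move=> <-; exists [::].
move=> [e1 sx] /IH pth; have [i' [j [/andP[ij j4] si tj eij]]] := ord e1.
have ii : i = i' by apply: vs1_inj; rewrite // -xi -sx si.
have [s [ps ys ms]] := pth _ j4 tj; exists (j :: s) => /=; split => //.
  by rewrite ii ij.
by rewrite eij ms ii.
Qed.

Lemma arcs_directed_path x p y i s : map lab p = map vs (arcs i s) ->
  path ltn i s -> all (gtn 4) s -> lab x = vs [:: i] ->
  lab y = vs [:: last i s] -> directed_path x p y.
Proof.
elim: s i x p => [|j s IH] i x [|e p] //= => [_ _ _ xi yi|].
  by apply: (lab_inj L); rewrite xi yi.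
move=> [ej pj] /andP[ij ps] /andP[j4 s4] xi yj.
have e1 : cdim e = 1%N.
  have := card_lab L e; rewrite ej card_vs.
  have {ij j4 IH xi yj ps ej pj} ij4 : (i < j < 4)%N by rewrite ij.
  by elim/edge_ind: ij4 => -[].
have [i' [j' [ij' si tj eij]]] := ord e1.
have [ei ej'] : i = i' /\ j = j'.
  by apply: vs2_inj; rewrite ?ij ?j4 // -ej eij.
split => //; first by apply: (lab_inj L); rewrite si -ei xi.
by apply: (IH j) => //; rewrite tj ej'.
Qed.

(** Vertex numbers strictly increase along a directed path. *)
Lemma acyclic (x : bary T) p : directed_path x p x -> p = [::].
Proof.
case: p => // e p /[dup] + /=; move=> /[swap] -[e1 <- _].
have [i [j [ij si _ _]]] := ord e1.
have i4 : (i < 4)%N by lia.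
move=> /(directed_path_arcs i4 si)[[|k s] [pth + ms]]; first by case: ms.
rewrite si => /(vs1_inj i4) e'; exfalso.
have : all (ltn i) (k :: s) by rewrite (order_path_min ltn_trans) //.
have {}e' : i = last k s := e'.
by move=> /allP/(_ _ (mem_last k s)); rewrite /= -e' ltnn.
Qed.

End Ordered.

Definition on_path (s : seq nat) (A : {set 'I_4}) : bool :=
  has (fun l => A \subset vs l) (arcs 0 s).

Lemma path_support_lab p s v x : map lab p = map vs (arcs 0 s) -> cell v x ->
  path_support p x <-> on_path s (lab v).
Proof.
move=> ps vx; rewrite /on_path -(has_map vs (fun A => lab v \subset A)) -ps.
rewrite has_map; split => [[e /= ep]|/hasP[e ep /= ve]].
  by move=> /(closure_cell_lab L e vx) ve; apply/hasP; exists e.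
by exists e => //; exact/(closure_cell_lab L e vx).
Qed.

Section Support.
Variables sWE sEW : seq nat.
Hypotheses (mWE : map lab (merWE T) = map vs (arcs 0 sWE))
           (mEW : map lab (merEW T) = map vs (arcs 0 sEW)).

Lemma meridians_lab v x : cell v x ->
  meridians x <-> on_path sWE (lab v) || on_path sEW (lab v).
Proof.
move=> vx; rewrite /meridians /setU /= (path_support_lab mWE vx).
by rewrite (path_support_lab mEW vx); exact/(rwP orP).
Qed.

Lemma off_meridians_lab v x : cell v x ->
  (cell_boundary (cell O) `\` @meridians R T) x <->
  [&& lab v != [set: 'I_4]%SET, ~~ on_path sWE (lab v)
    & ~~ on_path sEW (lab v)].
Proof.
move=> vx; rewrite /setD /= (boundary_top L) (meridians_lab vx) (lab_eqT L).
rewrite -negb_or; split => [[vO nm]|/andP[vO /negP nm]].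
  by apply/andP; split; [apply/eqP => e; rewrite e in vx|exact/negP].
by split => // /(cell_eq vx) e; rewrite e eqxx in vO.
Qed.

End Support.
End Meridians.

(** * Sorting the vertices *)

Lemma vs_set1 (i : 'I_4) : [set i]%SET = vs [:: val i].
Proof. by apply/setP => j; rewrite !inE. Qed.

Lemma vs_set2 (i j : 'I_4) : [set i; j]%SET = vs [:: val i; val j].
Proof. by apply/setP => k; rewrite !inE. Qed.

Section Sorting.
Context {R : realType} (T : template_data R).
Variables (O : bary T) (h : T -> 'rV[R]_4) (lab : bary T -> {set 'I_4}).
Hypothesis L : tetra_labelling O h lab.
Hypothesis edgesT : is_edge_orientation T.
Hypothesis acyclicT :
  forall (x : bary T) (p : seq (bary T)), directed_path x p x -> p = [::].

Lemma edge_ends (e : bary T) : cdim e = 1%N -> exists i j : 'I_4,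
  [/\ i != j, lab (src e) = [set i]%SET, lab (tgt e) = [set j]%SET
    & lab e = [set i; j]%SET].
Proof.
move=> e1; have [s0 t0 st be] := edgesT e1.
have /eqP/cards1P[i si] : #|lab (src e)| = 1%N by rewrite (card_lab L) s0.
have /eqP/cards1P[j tj] : #|lab (tgt e)| = 1%N by rewrite (card_lab L) t0.
have ij : i != j.
  by apply: contra_neq st => ij; apply: (lab_inj L); rewrite si tj ij.
have : lab (src e) \proper lab e.
  by apply/(sub_boundary_cell_lab L); rewrite be => x; left.
have : lab (tgt e) \proper lab e.
  by apply/(sub_boundary_cell_lab L); rewrite be => x; right.
rewrite si tj => /proper_sub; rewrite finset.sub1set => je.
move=> /proper_sub; rewrite finset.sub1set => ie.
exists i, j; split => //; apply/esym/eqP.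
rewrite eqEcard finset.subUset !finset.sub1set ie je (card_lab L) e1 cards2 ij.
by [].
Qed.

Let arrow (i j : 'I_4) : bool := `[< exists2 e : bary T, cdim e = 1%N &
  lab (src e) = [set i]%SET /\ lab (tgt e) = [set j]%SET >].

(** Any two vertices of a tetrahedron span an edge. *)
Let arrow_total i j : i != j -> arrow i j || arrow j i.
Proof.
move=> ij; have [|e eij] := lab_surj L (_ : [set i; j]%SET != finset.set0).
  by apply/set0Pn; exists i; rewrite !inE eqxx.
have e1 : cdim e = 1%N.
  by have := card_lab L e; rewrite eij cards2 ij => -[].
have [i' [j' [ij' si tj eij']]] := edge_ends e1.
move: (eij); rewrite eij' => /setP E.
have := E i'; have := E j'; rewrite !inE !eqxx orbT /= => /esym j'E /esym i'E.
case/orP: i'E => /eqP ei; case/orP: j'E => /eqP ej; subst i' j'.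
- by rewrite eqxx in ij'.
- by apply/orP; left; apply/asboolP; exists e.
- by apply/orP; right; apply/asboolP; exists e.
- by rewrite eqxx in ij'.
Qed.

Let arrow_antisym i j : arrow i j -> arrow j i -> False.
Proof.
move=> /asboolP[e e1 [si tj]] /asboolP[e' e1' [sj ti]].
suff : directed_path (src e) [:: e; e'] (src e) by move/acyclicT.
split => //; split => //=; first by apply: (lab_inj L); rewrite sj tj.
by apply: (lab_inj L); rewrite ti si.
Qed.

(** Otherwise the edge between [i] and [k] would close a directed triangle. *)
Let arrow_trans i j k : arrow i j -> arrow j k -> arrow i k.
Proof.
move=> ij jk; have [ik|ik] := eqVneq i k.
  by subst k; case: (arrow_antisym ij jk).
case/orP: (arrow_total ik) => // ki; exfalso.
move: ij jk ki => /asboolP[e e1 [si tj]] /asboolP[e' e1' [sj tk]].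
move=> /asboolP[e'' e1'' [sk ti]].
suff : directed_path (src e) [:: e; e'; e''] (src e) by move/acyclicT.
split => //; split => //=; first by apply: (lab_inj L); rewrite sj tj.
split => //; first by apply: (lab_inj L); rewrite sk tk.
by apply: (lab_inj L); rewrite ti si.
Qed.

(** The number of predecessors of a vertex, which is its position in the linear order. *)
Let score (i : 'I_4) : nat := #|[set k | arrow k i]%SET|.

Let score_lt4 i : (score i < 4)%N.
Proof.
rewrite -[X in (_ < X)%N](card_ord 4) -cardsT; apply/proper_card.
rewrite finset.properT; apply/eqP => /setP/(_ i).
rewrite finset.in_set finset.in_setT => ii.
exact: (@arrow_antisym i i).
Qed.

Let score_mono i j : arrow i j -> (score i < score j)%N.
Proof.
move=> ij; apply/proper_card/properP; split.
  apply/fintype.subsetP => k; rewrite !finset.in_set => ki.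
  exact: arrow_trans ki ij.
exists i; rewrite finset.in_set //; apply/negP => ii.
exact: (@arrow_antisym i i).
Qed.

Let rank (i : 'I_4) : 'I_4 := Ordinal (score_lt4 i).

Let rank_inj : injective rank.
Proof.
move=> i j [e]; apply/eqP; apply: contraT => /arrow_total/orP[] /score_mono.
  by rewrite e ltnn.
by rewrite e ltnn.
Qed.

(* An acyclic orientation of the complete graph is a linear order. *)
Lemma sorted_labelling : exists h' (lab' : bary T -> {set 'I_4}),
  tetra_labelling O h' lab' /\ ordered_edges lab'.
Proof.
pose s := perm rank_inj.
exists (permute_coord s \o h), (fun v => s @: lab v).
split; first exact: relabelling.
move=> e e1; have [i [j [ij si tj eij]]] := edge_ends e1.
exists (score i), (score j); split.
- by rewrite score_lt4 andbT; apply: score_mono; apply/asboolP; exists e.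
- by rewrite si imset_set1 permE vs_set1.
- by rewrite tj imset_set1 permE vs_set1.
- by rewrite eij imsetU !imset_set1 !permE vs_set2.
Qed.

End Sorting.

(** * Classification *)

Section Codes.
Local Open Scope nat_scope.
Implicit Types l s r : seq nat.

Definition on_path_code s l : bool := has (subcode l) (arcs 0 s).

Lemma on_path_vs s l : on_path s (vs l) = on_path_code s l.
Proof. by apply: eq_has => l'; exact: sub_vs. Qed.

Lemma neqT_vs l : (vs l != [set: 'I_4]%SET) = ~~ subcode [:: 0; 1; 2; 3] l.
Proof. by rewrite -finset.subTset vs_full sub_vs. Qed.

Lemma neq0_vs l : (vs l != finset.set0) = ~~ subcode l [::].
Proof. by rewrite -finset.subset0 vs0 sub_vs. Qed.

(** Two increasing paths from 0 to 3 that share an edge other than 03 also share vertex 1 or 2, so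
    three tests suffice. *)
Definition disjoint_paths s s' : bool :=
  all (fun l => ~~ (on_path_code s l && on_path_code s' l))
    [:: [:: 1]; [:: 2]; [:: 0; 3]].

Definition hemisphere_code : Type :=
  (seq nat * seq nat * (seq nat * seq nat))%type.

(* Two disjoint meridians, and the least labels of the two components of
   their complement in the boundary sphere. *)
Definition meridian_complements : seq hemisphere_code :=
  [:: ([:: 3], [:: 1; 3], ([:: 0; 1; 3], [:: 2]));
      ([:: 1; 3], [:: 3], ([:: 0; 1; 3], [:: 2]));
      ([:: 2; 3], [:: 3], ([:: 1], [:: 3; 2; 0]));
      ([:: 3], [:: 2; 3], ([:: 1], [:: 3; 2; 0]));
      ([:: 3], [:: 1; 2; 3], ([:: 0; 2], [:: 1; 3]));
      ([:: 1; 2; 3], [:: 3], ([:: 0; 2], [:: 1; 3]));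
      ([:: 1; 3], [:: 2; 3], ([:: 0; 3], [:: 1; 2]));
      ([:: 2; 3], [:: 1; 3], ([:: 0; 3], [:: 1; 2]))].

(** Exhaustive evaluation over the sixteen ordered pairs of increasing paths. *)
Lemma disjoint_paths_complement s s' :
  s \in increasing_paths -> s' \in increasing_paths -> disjoint_paths s s' ->
  exists rr, (s, s', rr) \in meridian_complements.
Proof.
move=> hs hs' d.
have : all (fun s => all (fun s' => disjoint_paths s s' ==>
    ((s, s') \in map fst meridian_complements)) increasing_paths)
    increasing_paths by [].
move=> /allP/(_ s hs)/allP/(_ s' hs')/implyP/(_ d)/mapP[[p rr] c /= ->].
by exists rr.
Qed.

Definition complement_code (c : hemisphere_code) : bool :=
  let: (s, s', (r, r')) := c in
  [&& ~~ subcode r [::], ~~ subcode r' [::],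
      ~~ subcode [:: 0; 1; 2; 3] r, ~~ subcode [:: 0; 1; 2; 3] r' &
  all (fun l => [&& ~~ subcode [:: 0; 1; 2; 3] l,
      ~~ on_path_code s l & ~~ on_path_code s' l] ==
    (subcode r l || subcode r' l) && ~~ subcode [:: 0; 1; 2; 3] l) vertex_sets].

Lemma complement_codeP s s' r r' : complement_code (s, s', (r, r')) ->
  forall A : {set 'I_4},
  [&& A != [set: 'I_4]%SET, ~~ on_path s A & ~~ on_path s' A] =
  ((vs r \subset A) || (vs r' \subset A)) && (A != [set: 'I_4]%SET).
Proof.
move=> /and5P[_ _ _ _]; apply: all_vertex_sets => l /eqP.
by rewrite -!neqT_vs -!on_path_vs -!sub_vs.
Qed.

(* Clause (iii) of the definition of a template for an edge from i to j in
   the star of r. *)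
Definition directed_west s s' r : bool :=
  all (fun ij : nat * nat => ~~ [&& 0 < ij.1,
      on_path_code s [:: ij.1] || on_path_code s' [:: ij.1]
    & subcode r [:: ij.1; ij.2]])
    [:: (0, 1); (0, 2); (0, 3); (1, 2); (1, 3); (2, 3)].

Definition directed_east s s' r : bool :=
  all (fun ij : nat * nat => ~~ [&& ij.2 < 3,
      on_path_code s [:: ij.2] || on_path_code s' [:: ij.2]
    & subcode r [:: ij.1; ij.2]])
    [:: (0, 1); (0, 2); (0, 3); (1, 2); (1, 3); (2, 3)].

(** The dropped rows have meridians 013 and 023. There the edge 12 lies in a hemisphere and joins
    two meridian vertices, so clause (iii) would direct it towards both or away from both. *)
Definition template_codes : seq hemisphere_code := take 6 meridian_complements.

(** The first six rows list West first. In the first four the edge 12 distinguishes West from East,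
    in the next two the edges 02 and 13 do. *)
Lemma template_codeP s s' r r' : (s, s', (r, r')) \in meridian_complements ->
  (directed_west s s' r && directed_east s s' r' ->
    (s, s', (r, r')) \in template_codes) /\
  (directed_west s s' r' && directed_east s s' r ->
    (s, s', (r', r)) \in template_codes).
Proof.
move=> c.
have : all (fun c : hemisphere_code => let: (s, s', (r, r')) := c in
    (directed_west s s' r && directed_east s s' r' ==> (c \in template_codes))
    && (directed_west s s' r' && directed_east s s' r ==>
        ((s, s', (r', r)) \in template_codes))) meridian_complements by [].
by move=> /allP/(_ _ c)/andP[/implyP ? /implyP ?].
Qed.

End Codes.

Section Classification.
Context {R : realType}.

Definition coded (T : template_data R) (c : hemisphere_code) : Prop :=
  presented T c.1.1 c.1.2 c.2.1 c.2.2.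

Lemma tetrahedron_template_coded (T : template_data R) :
  tetrahedron_template T -> exists2 c, c \in template_codes & coded T c.
Proof.
move=> [] [top'] [[dim' cl'] bip mer hem [dir _ _]].
move=> /solid_tetrahedron_labelling[top [h0 [lab0 L0]]].
(* Only the 3-cell of the labelling has a label with four vertices. *)
have topE : top' = top.
  apply/eqP; rewrite -(lab_eqT L0) eqEcard finset.subsetT cardsT card_ord.
  by rewrite (card_lab L0) dim'.
subst top'; have [edges acyc N S] := bip.
have [h [lab [L o]]] := sorted_labelling L0 edges acyc; move: L0 => _ {h0 lab0}.
have pN : lab (poleN T) = vs [:: 0%N].
  have [|v v0] := lab_surj L (_ : vs [:: 0%N] != finset.set0).
    by rewrite neq0_vs.
  rewrite -v0; congr lab; apply/esym/N; split.
    by apply/(lab_vertex L); exists 0%N.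
  move=> e /o[i [j [/andP[ij j4] _ tj _]]] ev; move: tj; rewrite ev v0.
  by move=> /(vs1_inj (isT : (0 < 4)%N)) j0; rewrite -j0 in ij.
have pS : lab (poleS T) = vs [:: 3].
  have [|v v3] := lab_surj L (_ : vs [:: 3] != finset.set0).
    by rewrite neq0_vs.
  rewrite -v3; congr lab; apply/esym/S; split.
    by apply/(lab_vertex L); exists 3.
  move=> e /o[i [j [/andP[ij j4] si _ _]]] ev; move: si; rewrite ev v3.
  move=> /(vs1_inj (isT : (3 < 4)%N)) i3; rewrite -i3 in ij.
  by have := leq_trans j4 ij; rewrite ltnn.
have [dWE dEW disj] := mer.
have meridian p : directed_path (poleN T) p (poleS T) -> exists2 s,
    s \in increasing_paths & map lab p = map vs (arcs 0 s).
  move=> /(directed_path_arcs o (isT : (0 < 4)%N) pN)[s [ps]].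
  rewrite pS => /(vs1_inj (isT : (3 < 4)%N))/esym s3 ms; exists s => //.
  exact: path_ltn_from0_to3.
have [sWE iWE mWE] := meridian _ dWE; have [sEW iEW mEW] := meridian _ dEW.
have d : disjoint_paths sWE sEW.
  apply/allP => l hl; apply/negP; rewrite -!on_path_vs => /andP[lWE lEW].
  have [|v vl] := lab_surj L (_ : vs l != finset.set0).
    by rewrite neq0_vs; move: hl; rewrite !inE => /or3P[] /eqP ->.
  have [x vx] := cell_nonempty v.
  have : (path_support (merWE T) `&` path_support (merEW T)) x.
    split; first by apply/(path_support_lab L mWE vx); rewrite vl.
    by apply/(path_support_lab L mEW vx); rewrite vl.
  rewrite disj => -[] /(cell_eq vx) e; move: vl; rewrite e ?pN ?pS => /eqP;
    rewrite eq_vs; by move: hl; rewrite !inE => /or3P[] /eqP ->.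
have [[r r'] c] := disjoint_paths_complement iWE iEW d.
have cc : complement_code (sWE, sEW, (r, r')).
  have : all complement_code meridian_complements by [].
  by move=> /allP/(_ _ c).
have offP := complement_codeP cc.
have [r0 r'0 _ _ _] := and5P cc; rewrite -!neq0_vs in r0 r'0.
have [cW cE WE hemM] := hem.
set M := _ `\` _ in cW cE hemM.
have eM : M = star lab r `|` star lab r'.
  apply/predeqP => x; have [v vx] := cell_of x.
  rewrite /M (off_meridians_lab L mWE mEW vx) offP /setU /=.
  rewrite (starP lab r vx) (starP lab r' vx) andb_orl.
  by split => /orP.
have onP x v : cell v x -> meridians x <->
    on_path sWE (lab v) || on_path sEW (lab v).
  by move=> vx; exact: (meridians_lab L mWE mEW vx).
have edge_in r1 e i j : lab e = vs [:: i; j] -> (i < j < 4)%N ->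
    subcode r1 [:: i; j] -> cell e `<=` star lab r1.
  move=> eij ij4 ri x ex; apply/(starP lab r1 ex).
  rewrite eij sub_vs ri /= neqT_vs.
  by elim/edge_ind: ij4 {eij ri}.
have vertex_on k v : lab v = vs [:: k] ->
    on_path_code sWE [:: k] || on_path_code sEW [:: k] ->
    cell v `<=` @meridians R T.
  by move=> vk; rewrite -!on_path_vs => km x vx; apply/(onP _ _ vx); rewrite vk.
have arc_edges (i j : nat) : (i, j) \in
    [:: (0, 1); (0, 2); (0, 3); (1, 2); (1, 3); (2, 3)]%N ->
    exists e : bary T, [/\ cdim e = 1%N, (i < j < 4)%N,
      lab (src e) = vs [:: i], lab (tgt e) = vs [:: j]
      & lab e = vs [:: i; j]].
  move=> hij; have ij4 : (i < j < 4)%N.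
    by move: hij; rewrite !inE => /or4P[||| /or3P[]] /eqP[-> ->].
  have [e e1 eij] := lab_edge L ij4.
  have [i' [j' [ij' si tj eij']]] := o e e1; exists e; split => //.
    by rewrite si; have [<- _] := vs2_inj ij4 ij' (etrans (esym eij) eij').
  by rewrite tj; have [_ <-] := vs2_inj ij4 ij' (etrans (esym eij) eij').
(* A western edge leaving a nonpolar meridian vertex would have to end at that same vertex. *)
have dirW r1 : hemW T = star lab r1 -> directed_west sWE sEW r1.
  move=> hW; apply/allP => -[i j] /arc_edges[e [e1 ij4 si tj eij]].
  apply/negP => /and3P[/= i0 im ri].
  have [i4 j4 ij i3 j0] := edge_bounds ij4.
  have [||||||tW tE] := dir (src e) e.
  - by apply/(lab_vertex L); exists i.
  - exact: vertex_on si im.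
  - move=> eN; move: si; rewrite eN pN => /(vs1_inj (isT : (0 < 4)%N)) e0.
    by rewrite -e0 in i0.
  - move=> eS; move: si; rewrite eS pS => /(vs1_inj (isT : (3 < 4)%N)) e3.
    by rewrite -e3 in i3.
  - exact: e1.
  - by left.
  have ts : tgt e = src e by apply: tW; rewrite hW; exact: edge_in eij ij4 ri.
  by move: tj; rewrite ts si => /(vs1_inj i4)/eqP; rewrite (negPf ij).
have dirE r1 : hemE T = star lab r1 -> directed_east sWE sEW r1.
  move=> hE; apply/allP => -[i j] /arc_edges[e [e1 ij4 si tj eij]].
  apply/negP => /and3P[/= j3 jm ri].
  have [i4 j4 ij i3 j0] := edge_bounds ij4.
  have [||||||tW tE] := dir (tgt e) e.
  - by apply/(lab_vertex L); exists j.
  - exact: vertex_on tj jm.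
  - move=> eN; move: tj; rewrite eN pN => /(vs1_inj (isT : (0 < 4)%N)) e0.
    by rewrite -e0 in j0.
  - move=> eS; move: tj; rewrite eS pS => /(vs1_inj (isT : (3 < 4)%N)) e3.
    by rewrite -e3 in j3.
  - exact: e1.
  - by right.
  have ts : src e = tgt e by apply: tE; rewrite hE; exact: edge_in eij ij4 ri.
  by move: tj; rewrite -ts si => /(vs1_inj i4)/eqP; rewrite (negPf ij).
have [cW_E cE_W] := template_codeP c.
have [[hW hE]|[hW hE]] := component_stars L r0 r'0 eM cW cE WE hemM.
  exists (sWE, sEW, (r, r')); first by apply: cW_E; rewrite dirW ?dirE.
  by exists top, h, lab.
exists (sWE, sEW, (r', r)); first by apply: cE_W; rewrite dirW ?dirE.
by exists top, h, lab.
Qed.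

End Classification.

(** * Realization *)

Section ModelTemplate.
Context {R : realType}.

(** The default, vertex 0, is reached only when [l] codes the empty set. *)
Definition code_label (l : seq nat) : label_type :=
  insubd (exist _ (vs [:: 0%N]) (neq0_vs [:: 0%N]) : label_type) (vs l).

Lemma val_code_label l : ~~ subcode l [::] -> val (code_label l) = vs l.
Proof. by rewrite -neq0_vs => l0; rewrite insubdK. Qed.

Lemma val_code_label1 i : (i < 4)%N -> val (code_label [:: i]) = vs [:: i].
Proof. by move=> i4; apply: val_code_label; case: i i4 => [|[|[|[|]]]]. Qed.

(** The enumeration is increasing, so for an edge its head and last entry are the source and the
    target. *)
Definition vertex_code (v : label_type) : seq nat := map val (enum (val v)).

Lemma enum_vs l : map val (enum (vs l)) = [seq k <- iota 0 4 | k \in l].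
Proof.
rewrite -val_enum_ord enumT filter_map; congr map.
by rewrite /enum_mem; apply: eq_filter => i; rewrite /= !inE.
Qed.

Definition model_template (c : hemisphere_code) : template_data R :=
  @TemplateData R (@simplex_complex R)
    (fun v => code_label [:: head 0%N (vertex_code v)])
    (fun v => code_label [:: last 0%N (vertex_code v)])
    (code_label [:: 0%N]) (code_label [:: 3])
    (map code_label (arcs 0 c.1.1)) (map code_label (arcs 0 c.1.2))
    (@star R (@simplex_complex R) val c.2.1)
    (@star R (@simplex_complex R) val c.2.2).

Lemma simplex_labelling :
  @tetra_labelling R (@simplex_complex R) (code_label [:: 0; 1; 2; 3]%N)
    set_val val.
Proof.
have vT : val (code_label [:: 0; 1; 2; 3]%N) = [set: 'I_4]%SET.
  by rewrite val_code_label // vs_full.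
have bx x : cell_boundary (@simplex_cell R (code_label [:: 0; 1; 2; 3]%N)) x <->
    ~ open_face [set: 'I_4]%SET (set_val x).
  rewrite /cell_boundary closure_simplex_cell vT /setD /= /simplex_cell /= vT.
  by split => [[]//|]; split => //; exact: set_valP.
split.
- by rewrite /= vT cardsT card_ord.
- rewrite /= closure_simplex_cell vT; apply/seteqP; split => // x _.
  exact: set_valP.
- apply: homeo_on_subset (@homeo_on_simplex R) => //.
    by move=> x [A _ xA]; exact: sub_open_face_simplex xA.
  move=> x _; rewrite bx; split => [nx|[A /= AT xA] xT].
    have [B [_ xB _]] := open_face_supp (set_valP x).
    by exists B => //=; apply: contra_notN nx => /eqP e; move: xB; rewrite {1}e.
  by rewrite (open_face_inj xA xT) eqxx in AT.
- exact: vT.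
- by move=> v vO; split; [exact: card_label|exact: image_simplex_cell].
Qed.

Lemma labelling_solid_tetrahedron (C : regular_complex R) (O : bary C) h lab :
  tetra_labelling O h lab -> solid_tetrahedron C.
Proof.
move=> [dimO clO hh _ labP]; exists O; split => //; exists h; split => // v vO.
by exists (lab v); exact: labP.
Qed.

Lemma presented_model (c : hemisphere_code) :
  c.1.1 \in increasing_paths -> c.1.2 \in increasing_paths ->
  coded (model_template c) c.
Proof.
move=> h1 h2; exists (code_label [:: 0; 1; 2; 3]%N), set_val, val.
have arcsE s : s \in increasing_paths ->
    map val (map code_label (arcs 0 s)) = map vs (arcs 0 s).
  move=> hs; rewrite -map_comp; apply/eq_in_map => l ls /=.
  apply: val_code_label; have : all (fun s => all (fun l => ~~ subcode l [::])
    (arcs 0 s)) increasing_paths by [].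
  by move=> /allP/(_ _ hs)/allP; apply.
split => //.
- exact: simplex_labelling.
- move=> e /= e1; have [l hl el] := vs_surj (val e).
  have : count (mem l) (iota 0 4) = 2 by rewrite -card_vs -el card_label e1.
  have : all (fun l : seq nat => (count (mem l) (iota 0 4) == 2%N) ==>
    [&& l == [:: head 0%N l; last 0%N l], (head 0 l < last 0 l < 4)%N &
      [seq k <- iota 0 4 | k \in l] == l]) vertex_sets by [].
  move=> /allP/(_ _ hl)/implyP + /eqP l2.
  move=> /(_ l2)/and3P[/eqP l_eq lt4 /eqP lf].
  exists (head 0%N l), (last 0%N l).
  rewrite /vertex_code el enum_vs lf.
  split => //; last by rewrite -l_eq.
    by apply: val_code_label1; case/andP: lt4; exact: ltn_trans.
  by apply: val_code_label1; case/andP: lt4.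
- by split; rewrite /= val_code_label.
- by split => /=; exact: arcsE.
Qed.

End ModelTemplate.

(** * The template axioms in decidable form *)

Section ValidCodes.
Local Open Scope nat_scope.

Definition card_code (l : seq nat) : nat := count (mem l) (iota 0 4).

Definition eq_code (l l' : seq nat) : bool := subcode l l' && subcode l' l.

Lemma eq_codeP l l' : reflect (vs l = vs l') (eq_code l l').
Proof. by rewrite /eq_code -!sub_vs -finset.eqEsubset; exact: eqP. Qed.

Definition polar_paths (s s' : seq nat) : bool :=
  all (fun l => ~~ subcode l [::] ==> (on_path_code s l && on_path_code s' l ==
    eq_code l [:: 0] || eq_code l [:: 3])) vertex_sets.

Definition incomparable_codes (r r' : seq nat) : bool :=
  all (fun l => all (fun l' =>
    [&& subcode r l, ~~ subcode [:: 0; 1; 2; 3] l, subcode r' l' &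
      ~~ subcode [:: 0; 1; 2; 3] l'] ==> ~~ subcode l l' && ~~ subcode l' l)
    vertex_sets) vertex_sets.

Lemma incomparable_codesP r r' : incomparable_codes r r' ->
  incomparable_stars r r'.
Proof.
move=> /allP rr' A B.
have [l hl ->] := vs_surj A; have [l' hl' ->] := vs_surj B.
have /allP/(_ _ hl')/implyP := rr' _ hl; rewrite !neqT_vs !sub_vs => H a b c d.
by apply: H; rewrite a b c d.
Qed.

Definition unique_face_code (r l f : seq nat) : bool :=
  [&& card_code f == 3, subcode r f, subcode l f, card_code l == 2 &
    all (fun f' => [&& card_code f' == 3, subcode r f' & subcode l f'] ==>
      eq_code f f') vertex_sets].

(** The default [[:: 0; 1; 2; 3]] codes the label of the 3-cell, which is the default in
    [three_cell_template]; labels thus commute with [head] and [last]. *)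
Definition overlap_code (s r r' f f' : seq nat) : bool :=
  [&& unique_face_code r (head [:: 0; 1; 2; 3] (arcs 0 s)) f,
      unique_face_code r' (last [:: 0; 1; 2; 3] (arcs 0 s)) f' &
      has (fun l => [&& card_code l == 2, subcode l f & subcode l f'])
        (arcs 0 s)].

(** The groups are: meridians meeting at the poles, their complement, its separation into two stars,
    clause (iii), clause (iv). Bipolarity comes from the increasing numbering instead. *)
Definition valid_code (c : hemisphere_code) : bool :=
  let: (s, s', (r, r')) := c in
  [&& [&& s \in increasing_paths, s' \in increasing_paths & polar_paths s s'],
      complement_code c, incomparable_codes r r' && incomparable_codes r' r,
      directed_west s s' r && directed_east s s' r' &
      has (fun f => has (overlap_code s r r' f) vertex_sets) vertex_sets &&
      has (fun f => has (overlap_code s' r r' f) vertex_sets) vertex_sets].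

End ValidCodes.

Lemma sub_star (R : realType) (C : regular_complex R)
    (lab : bary C -> {set 'I_4}) r v :
  cell v `<=` star lab r <-> (vs r \subset lab v) && (lab v != [set: 'I_4]%SET).
Proof.
have [x vx] := cell_nonempty v.
split => [|rv y vy]; last exact/(starP lab r vy).
by move=> /(_ _ vx)/(starP lab r vx).
Qed.

Section ValidTemplate.
Context {R : realType} (T : template_data R).
Variables (O : bary T) (h : T -> 'rV[R]_4) (lab : bary T -> {set 'I_4}).
Hypothesis L : tetra_labelling O h lab.

Lemma card_code_lab (v : bary T) l : lab v = vs l -> card_code l = (cdim v).+1.
Proof. by move=> vl; rewrite -(card_lab L) vl card_vs. Qed.

Lemma face_at_star r (e f : bary T) l l' : lab e = vs l -> lab f = vs l' ->
  card_code l = 2%N ->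
  face_at (star lab r) e f <->
  [&& card_code l' == 3, subcode r l' & subcode l l'].
Proof.
move=> el fl l2; have c' := card_code_lab fl.
have cl : lab e \proper lab f <-> (subcode l l' && (2 < card_code l'))%N.
  by rewrite finset.properEcard el fl sub_vs !card_vs -!/(card_code _) l2.
have sl : cell f `<=` star lab r <-> subcode r l' && (card_code l' < 4)%N.
  apply: iff_trans (sub_star _ _ _) _; rewrite fl sub_vs.
  by rewrite -finset.properT finset.properEcard finset.subsetT cardsT card_ord
     card_vs.
split=> [[f2 /sl/andP[rf _] /(sub_boundary_cell_lab L)/cl/andP[lf _]]|].
  by rewrite c' f2 rf lf.
move=> /and3P[/eqP l3 rf lf]; split; first by move: c'; rewrite l3 => -[].
  by apply/sl; rewrite rf l3.
by apply/(sub_boundary_cell_lab L)/cl; rewrite lf l3.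
Qed.

Lemma unique_face r (e : bary T) l f : lab e = vs l -> unique_face_code r l f ->
  exists f' : bary T, lab f' = vs f /\ unique (face_at (star lab r) e) f'.
Proof.
move=> el /and5P[f3 rf lf /eqP l2 /allP uf].
have [|f' ff'] := lab_surj L (_ : vs f != finset.set0).
  by rewrite -card_gt0 card_vs -/(card_code _) (eqP f3).
exists f'; split => //; split; first by apply/(face_at_star r el ff' l2)/and3P.
move=> g; have [l' hl' gl'] := vs_surj (lab g).
move=> /(face_at_star r el gl' l2) /(implyP (uf _ hl')) /eq_codeP e'.
by apply: (lab_inj L); rewrite ff' gl'.
Qed.

Lemma overlap p s r r' f f' : map lab p = map vs (arcs 0 s) ->
  overlap_code s r r' f f' ->
  faces_overlap p (star lab r) (head O p) (star lab r') (last O p).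
Proof.
move=> ps /and3P[uf uf' /hasP[l ls /and3P[/eqP l2 lf lf']]].
have labO : lab O = vs [:: 0; 1; 2; 3]%N.
  by case: L => _ _ _ -> _; rewrite vs_full.
have hp : lab (head O p) = vs (head [:: 0; 1; 2; 3]%N (arcs 0 s)).
  by case: p (arcs 0 s) ps => [|e p] [|l0 q] //= [].
have lp : lab (last O p) = vs (last [:: 0; 1; 2; 3]%N (arcs 0 s)).
  by rewrite -last_map ps labO last_map.
have [f1 [lf1 uf1]] := unique_face hp uf.
have [f2 [lf2 uf2]] := unique_face lp uf'.
exists f1, f2; split => //.
have : vs l \in map lab p by rewrite ps; apply/mapP; exists l.
move=> /mapP[e ep /esym el]; exists e; split => //.
  apply/(sub_boundary_cell_lab L); rewrite finset.properEcard el lf1 sub_vs lf.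
  by rewrite !card_vs -!/(card_code _) l2; have /and5P[/eqP -> _ _ _ _] := uf.
apply/(sub_boundary_cell_lab L); rewrite finset.properEcard el lf2 sub_vs lf'.
by rewrite !card_vs -!/(card_code _) l2; have /and5P[/eqP -> _ _ _ _] := uf'.
Qed.

(** The nonempty proper subsets of an edge label are its two ends, by evaluation for each of the six
    edges. *)
Lemma ordered_orientation : ordered_edges lab -> is_edge_orientation T.
Proof.
move=> o e e1; have [i [j [/andP[ij j4] si tj eij]]] := o e e1.
have i4 : (i < 4)%N := ltn_trans ij j4.
split.
- by apply/(lab_vertex L); exists i.
- by apply/(lab_vertex L); exists j.
- by apply/eqP => st; move: tj; rewrite -st si => /(vs1_inj i4); lia.
apply/predeqP => x; have [v vx] := cell_of x.
have vP w : cell w x <-> lab v = lab w.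
  by split => [/(cell_eq vx) -> //|/(lab_inj L) <-].
rewrite (boundary_cell_lab L e vx) /setU /= !vP si tj eij.
have := lab_neq0 L v; have [l hl ->] := vs_surj (lab v).
rewrite neq0_vs fintype.properE !sub_vs => l0.
have : all (fun l => ~~ subcode l [::] ==>
    ((subcode l [:: i; j] && ~~ subcode [:: i; j] l) ==
      (eq_code l [:: i] || eq_code l [:: j]))) vertex_sets.
  have ij4 : (i < j < 4)%N by rewrite ij.
  by elim/edge_ind: ij4 {e e1 si tj eij i4 ij j4}.
move=> /allP/(_ l hl)/implyP/(_ l0)/eqP ->.
by split => [/orP[]/eq_codeP ->|[]/eq_codeP ->]; rewrite ?orbT; auto.
Qed.

(** Every vertex other than 0 receives the edge from 0, and every vertex other than 3 emits the edge
    to 3; so 0 is the only source and 3 the only sink. *)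
Lemma ordered_bipolar : ordered_edges lab -> lab (poleN T) = vs [:: 0%N] ->
  lab (poleS T) = vs [:: 3] -> bipolar T.
Proof.
move=> o pN pS; split; first exact: ordered_orientation.
- exact: acyclic o.
- move=> v; split => [[v0 nv]|->].
    have [i i4 vi] := (lab_vertex L v).1 v0.
    apply: (lab_inj L); rewrite pN vi; case: i i4 vi => // i i4 vi.
    have i14 : (0 < i.+1 < 4)%N by [].
    have [e e1 e0i] := lab_edge L i14.
    have [k [j [kj _ tj ekj]]] := o e e1.
    have [_ ej] := vs2_inj kj i14 (etrans (esym ekj) e0i).
    by case: (nv e e1); apply: (lab_inj L); rewrite tj vi ej.
  split; first by apply/(lab_vertex L); exists 0%N.
  move=> e /o[i [j [ij _ tj _]]] te; move: tj; rewrite te pN.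
  by move=> /(vs1_inj (isT : (0 < 4)%N)); lia.
- move=> v; split => [[v0 nv]|->].
    have [i i4 vi] := (lab_vertex L v).1 v0.
    apply: (lab_inj L); rewrite pS vi; have [->//|i3] := eqVneq i 3.
    have i34 : (i < 3 < 4)%N by lia.
    have [e e1 e0i] := lab_edge L i34.
    have [k [j [kj sk _ ekj]]] := o e e1.
    have [ek _] := vs2_inj kj i34 (etrans (esym ekj) e0i).
    by case: (nv e e1); apply: (lab_inj L); rewrite sk vi ek.
  split; first by apply/(lab_vertex L); exists 3.
  move=> e /o[i [j [ij si _ _]]] se; move: si; rewrite se pS.
  by move=> /(vs1_inj (isT : (3 < 4)%N)); lia.
Qed.

End ValidTemplate.

Section Realization.
Context {R : realType}.

Lemma valid_code_template (T : template_data R) (c : hemisphere_code) :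
  valid_code c -> coded T c -> tetrahedron_template T.
Proof.
case: c => [[s s'] [r r']] /and5P[/and3P[hs hs' ss'] cc].
move=> /andP[rr' r'r] /andP[dW dE] /andP[/hasP[f1 _ /hasP[f2 _ ov]]].
move=> /hasP[g1 _ /hasP[g2 _ ov']] [top [h [lab [L o [pN pS] [mWE mEW] []]]]].
rewrite /= in mWE mEW * => hW hE.
split; last exact: labelling_solid_tetrahedron L.
have [dimO clO _ _ _] := L; exists top; split => //.
- exact: ordered_bipolar L o pN pS.
- have dir p q : q \in increasing_paths -> map lab p = map vs (arcs 0 q) ->
      directed_path (poleN T) p (poleS T).
    move=> hq pq; have : all (fun q => [&& path ltn 0%N q, all (gtn 4) q &
      last 0%N q == 3%N]) increasing_paths by [].
    move=> /allP/(_ _ hq)/and3P[pth q4 /eqP q3].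
    by apply: (arcs_directed_path L o pq pth q4 pN); rewrite q3.
  split; [exact: dir mWE|exact: dir mEW|].
  apply/predeqP => x; have [v vx] := cell_of x.
  have vP w : cell w x <-> lab v = lab w.
    by split => [/(cell_eq vx) -> //|/(lab_inj L) <-].
  rewrite /setI /setU /= (path_support_lab L mWE vx).
  rewrite (path_support_lab L mEW vx) !vP pN pS.
  have := lab_neq0 L v; have [l hl ->] := vs_surj (lab v).
  rewrite neq0_vs !on_path_vs => l0.
  have /implyP/(_ l0)/eqP E := allP ss' l hl.
  split => [[l1 l2]|h0].
    by move: E; rewrite l1 l2 => /esym/orP[] /eq_codeP; auto.
  by apply/andP; rewrite E; case: h0 => /eq_codeP ->; rewrite ?orbT.
- set M := _ `\` _.
  have eM : M = star lab r `|` star lab r'.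
    apply/predeqP => x; have [v vx] := cell_of x.
    rewrite /M (off_meridians_lab L mWE mEW vx) (complement_codeP cc) /setU /=.
    rewrite (starP lab r vx) (starP lab r' vx) andb_orl.
    by split => /orP.
  have [r0 r'0 rT r'T _] := and5P cc.
  rewrite -!neq0_vs in r0 r'0; rewrite -!neqT_vs in rT r'T.
  rewrite hW hE /=; split => //.
  + exact: (star_is_component L r0 rT (incomparable_codesP rr') eM).
  + apply: (star_is_component L r'0 r'T (incomparable_codesP r'r)).
    by rewrite setUC.
  + move=> e; have [u ur] := lab_surj L r0; have [x ux] := cell_nonempty u.
    have rx : star lab r x by apply/(starP lab r ux); rewrite ur subxx.
    have := separated_disjoint (star_separated L (incomparable_codesP rr')).
    by rewrite -e setIid => /seteqP[/(_ x rx)].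
- split.
  + move=> v e v0 von vN vS e1 ve.
    have [i [j [ij si tj eij]]] := o e e1.
    have [x vx] := cell_nonempty v.
    have := (meridians_lab L mWE mEW vx).1 (von _ vx).
    have in_edges : (i, j) \in
        [:: (0, 1); (0, 2); (0, 3); (1, 2); (1, 3); (2, 3)]%N.
      by elim/edge_ind: ij {si tj eij}.
    have sub q : cell e `<=` star lab q -> subcode q [:: i; j].
      by move=> /sub_star/andP[]; rewrite eij sub_vs.
    (* When [v] is the source, the eastern claim is immediate and a western edge contradicts
       [directed_west], as [v] is not the North pole; symmetrically when [v] is the target. *)
    rewrite hW hE /=; case: ve => ve; rewrite -ve ?si ?tj !on_path_vs => on.
      split => [/sub ri|_ //]; exfalso; move/negP: (allP dW _ in_edges); apply.
      rewrite /= on ri /= andbT lt0n; apply/eqP => i0; apply: vN.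
      by apply: (lab_inj L); rewrite -ve si i0 pN.
    split => [_ //|/sub ri]; exfalso; move/negP: (allP dE _ in_edges); apply.
    rewrite /= on ri /= andbT ltnNge; apply/negP => j3; apply: vS.
    apply: (lab_inj L); rewrite -ve tj pS; congr (vs [:: _]); lia.
  + by rewrite hW hE; exact: (overlap L mWE ov).
  + by rewrite hW hE; exact: (overlap L mEW ov').
Qed.

End Realization.

(** * Counting faces *)

Section Counting.
Context {R : realType}.

(** [vertex_sets] lists every subset exactly once. *)
Lemma card_vertex_sets (P : pred {set 'I_4}) :
  #|[set A | P A]%SET| = count (fun l => P (vs l)) vertex_sets.
Proof.
have vs_inj : {in vertex_sets &, injective vs}.
  move=> l l' hl hl' /eq_codeP e.
  have : all (fun l => all (fun l' => eq_code l l' ==> (l == l')) vertex_sets)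
    vertex_sets by [].
  by move=> /allP/(_ _ hl)/allP/(_ _ hl')/implyP/(_ e)/eqP.
rewrite -count_map -size_filter -(card_uniqP _); last first.
  by rewrite filter_uniq // map_inj_in_uniq.
apply: eq_card => A; rewrite !inE mem_filter andbC.
have [l hl ->] := vs_surj A.
by rewrite map_f.
Qed.

Lemma face_count_star (C : regular_complex R) (O : bary C) h lab r :
  tetra_labelling O h lab ->
  face_count (star lab r) =
    count (fun l => (card_code l == 3) && subcode r l) vertex_sets.
Proof.
move=> L; rewrite /face_count -(card_imset _ (lab_inj L)).
rewrite -(eq_count (a1 := fun l => (#|vs l| == 3) && (vs r \subset vs l))).
  rewrite -(card_vertex_sets (fun A => (#|A| == 3) && (vs r \subset A))).
  congr #|pred_of_set _|; apply/setP => A; rewrite [RHS]finset.in_set.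
  apply/imsetP/andP => [[f]|[A3 rA]].
    rewrite finset.in_set => /andP[f2 /asboolP /sub_star /andP[rf _]] ->.
    by rewrite (card_lab L) eqSS f2 rf.
  have [|f fA] := lab_surj L (_ : A != finset.set0).
    by rewrite -card_gt0 (eqP A3).
  exists f => //; rewrite finset.in_set -eqSS -(card_lab L) fA A3 /=.
  apply/asboolP; apply/sub_star; rewrite fA rA /=.
  by apply: contraTneq A3 => ->; rewrite cardsT card_ord.
by move=> l; rewrite card_vs sub_vs.
Qed.

Lemma smaller_face_count_coded (T : template_data R) (c : hemisphere_code) :
  coded T c -> smaller_face_count T =
    minn (count (fun l => (card_code l == 3) && subcode c.2.1 l) vertex_sets)
         (count (fun l => (card_code l == 3) && subcode c.2.2 l) vertex_sets).
Proof.
move=> [top [h [lab [L _ _ _ [hW hE]]]]].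
by rewrite /smaller_face_count hW hE !(face_count_star _ L).
Qed.

(** The edge 03 joins the poles, which are distinct. *)
Lemma pole_distance_coded (T : template_data R) (c : hemisphere_code) :
  coded T c -> pole_distance T 1.
Proof.
move=> [top [h [lab [L o [pN pS] _ _]]]]; split.
  have [e e1 e03] := lab_edge L (isT : (0 < 3 < 4)%N).
  have [i [j [ij si tj eij]]] := o e e1.
  have [i0 j3] := vs2_inj ij (isT : (0 < 3 < 4)%N) (etrans (esym eij) e03).
  exists [:: poleS T]; split => //=; rewrite andbT; apply/fintype.existsP.
  exists e; rewrite e1 eqxx /=; apply/orP; left; apply/andP; split; apply/eqP.
    by apply: (lab_inj L); rewrite si i0 pN.
  by apply: (lab_inj L); rewrite tj j3 pS.
case=> //= _ NS; move: pS; rewrite -NS pN.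
by move=> /(vs1_inj (isT : (0 < 4)%N)).
Qed.

Lemma face_count_iso (C C' : regular_complex R) (f : C -> C')
    (phi : bary C -> bary C') (H : set C) :
  homeo_on [set: C] [set: C'] f -> bijective phi ->
  (forall v, cdim (phi v) = cdim v /\ f @` cell v = cell (phi v)) ->
  face_count H = face_count (f @` H).
Proof.
move=> hf phi_bij phiP; rewrite /face_count -(card_imset _ (bij_inj phi_bij)).
congr #|pred_of_set _|; apply/setP => w; rewrite [RHS]finset.in_set.
have sub v : cell (phi v) `<=` f @` H <-> cell v `<=` H.
  rewrite -(phiP v).2; split => [s x vx|s]; last exact: image_subset.
  have [y Hy yx] : (f @` H) (f x) by apply: s; exists x.
  by rewrite -(homeo_on_inj hf _ _ yx).
have [psi phiK psiK] := phi_bij; rewrite -(psiK w) (phiP _).1.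
apply/imsetP/andP => [[v]|[dw /asboolP /sub Hw]].
  rewrite finset.in_set => /andP[dv /asboolP Hv] /(bij_inj phi_bij) ->.
  by split => //; apply/asboolP; apply/sub.
by exists (psi w) => //; rewrite finset.in_set dw; apply/asboolP.
Qed.

Lemma smaller_face_count_iso (T T' : template_data R) :
  template_iso T T' -> smaller_face_count T = smaller_face_count T'.
Proof.
move=> [f [phi [hf phi_bij phiP _ [_ _ _ hW hE]]]].
by rewrite /smaller_face_count -hW -hE -!(face_count_iso _ hf phi_bij phiP).
Qed.

(** [rho] keeps the hemispheres and [kappa] exchanges them, while the minimum is symmetric. *)
Lemma smaller_face_count_equivalent (T T' : template_data R) :
  trivially_equivalent T T' -> smaller_face_count T = smaller_face_count T'.
Proof.
by case => /smaller_face_count_iso -> //; rewrite /smaller_face_count minnC.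
Qed.

(** Named after the cycle formed by the two meridians: here it bounds the face 013, which is all of
    West. *)
Definition triangle_code : hemisphere_code :=
  ([:: 3], [:: 1; 3], ([:: 0; 1; 3], [:: 2]))%N.

(** The meridians form a 4-cycle through all vertices, with two faces on either side. *)
Definition quadrangle_code : hemisphere_code :=
  ([:: 3], [:: 1; 2; 3], ([:: 0; 2], [:: 1; 3]))%N.

(** This is literally the third row of [template_codes]: the order in [[:: 3; 2; 0]] is the one
    [flip] produces from [[:: 0; 1; 3]]. *)
Lemma coded_triangle_kappa (T : template_data R) : coded T triangle_code ->
  presented (kappa T) [:: 2; 3]%N [:: 3]%N [:: 1]%N [:: 3; 2; 0]%N.
Proof.
by apply: presented_kappa => //=; rewrite !imset_rev_vs //=;
  do ?congr (_ :: _); apply/eq_codeP.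
Qed.

(** The first four rows are the orbit of [T1] under the Klein group, the last two that of [T2]. The
    second orbit is shorter because renumbering [i] as [3 - i] preserves the 4-cycle and exchanges
    02 with 13, so [kappa] acts there like [rho] up to isomorphism. *)
Lemma coded_equivalent (T T1 T2 : template_data R) c :
  coded T1 triangle_code -> coded T2 quadrangle_code ->
  c \in template_codes -> coded T c ->
  trivially_equivalent T T1 \/ trivially_equivalent T T2.
Proof.
move=> h1 h2; have k1 := coded_triangle_kappa h1.
rewrite !inE => /or4P[||| /or3P[]] /eqP -> hT.
- by left; apply: Or41; exact: presented_iso hT h1.
- by left; apply: Or43; apply: presented_iso hT _; exact: presented_rho h1.
- by left; apply: Or42; exact: presented_iso hT k1.
- left; apply: Or44; apply: presented_iso hT _.
  (* [kappa (rho T1)] and [rho (kappa T1)] are convertible. *)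
  exact: (presented_rho k1).
- by right; apply: Or41; exact: presented_iso hT h2.
- by right; apply: Or43; apply: presented_iso hT _; exact: presented_rho h2.
Qed.

End Counting.

Local Close Scope ring_scope.
Local Close Scope classical_set_scope.

Theorem mainTheorem2 (R : realType) :
  exists T1 T2 : template_data R,
    [/\ tetrahedron_template T1 /\ tetrahedron_template T2,
        ~ trivially_equivalent T1 T2,
        forall T : template_data R, tetrahedron_template T ->
          trivially_equivalent T T1 \/ trivially_equivalent T T2,
        pole_distance T1 1 /\ pole_distance T2 1
      & smaller_face_count T1 = 1 /\ smaller_face_count T2 = 2].
Proof.
have h1 : coded (model_template triangle_code : template_data R) triangle_code.
  exact: presented_model.
have h2 :
    coded (model_template quadrangle_code : template_data R) quadrangle_code.
  exact: presented_model.
have c1 := smaller_face_count_coded h1; have c2 := smaller_face_count_coded h2.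
exists (model_template triangle_code), (model_template quadrangle_code); split.
- by split; [apply: valid_code_template h1|apply: valid_code_template h2].
(* The smaller face count is invariant under trivial equivalence and takes the values 1 and 2. *)
- by move=> /smaller_face_count_equivalent; rewrite c1 c2.
- move=> T /tetrahedron_template_coded[c hc].
  exact: coded_equivalent h1 h2 hc.
- by split; [exact: pole_distance_coded h1|exact: pole_distance_coded h2].
- by rewrite c1 c2.
Qed.
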